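(* Let $R$ be a nonzero commutative ring, $\mathcal{F}\colon \mathbf{MCob}\to R\mathbf{Mod}$ an MTQFT with $V=\mathcal{F}(1)$, $\mu_V=\mathcal F(\mu)$, $\Delta_V=\mathcal F(\Delta)$, $m_V=\mathcal F(m)$. Let $\mathcal{G}$ be a finitely generated abelian group with generators $g_1,\dots,g_m$, let $V=\bigoplus_{g\in\mathcal{G}}V_g$ be a $\mathcal{G}$-grading, and let $s=(s_1,\dots,s_m)\in\mathbb{Z}^m$. Suppose that $m_V^2=\mu_V\circ\Delta_V$ and that $\mu_V,\Delta_V,m_V$ all preserve the $\mathcal{G}$-grading up to the same constant shift, compensated by $s$ (so that the differential $\partial$ of the complex $C^{*,*}(\Gamma_M)$ has bidegree $(1,0)$). Then: (1) The graded Poincaré polynomial $$Mh(\Gamma_M)=\sum_i t^i\, q\mathrm{dim}\big(MH^{i,*}(\Gamma_M;R)\big)$$ of the Möbius homology is a ribbon graph invariant: it does not depend on the choices made in its construction (such as the ordering of the matching edges), and $Mh(\Gamma_M)=Mh(\Gamma'_{M'})$ whenever $\Gamma_M$ and $\Gamma'_{M'}$ are equivalent perfect matching graphs with trivalent underlying graphs. (2) For every perfect matching graph $\Gamma_M$ with trivalent underlying graph, the graded Euler characteristic $\sum_i(-1)^i\,q\mathrm{dim}\big(C^{i,*}(\Gamma_M)\big)$ of the underlying chain complex equals the bracket $\langle\Gamma_M\rangle$ with $A=1$, $B=-q_1^{s_1}q_2^{s_2}\cdots q_m^{s_m}$ and $C=q\mathrm{dim}(V)$.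
   Context: **Ribbon graphs.** Graphs are finite undirected multigraphs, connected with nonempty edge set. An (oriented) ribbon graph $\Gamma$ is a graph $G$ embedded in an oriented compact surface with boundary that deformation retracts onto $G$; equivalently, $G$ with a cyclic order of the half-edges at each vertex. It is represented by a ribbon diagram: a drawing of $G$ in the plane with vertices as dots and edges as curves that may cross (at most two at any point), inducing the given cyclic orders counterclockwise. Ribbon graphs are regarded as ribbon diagrams up to equivalence: a finite sequence of planar isotopies, Reidemeister-type moves (the three Reidemeister moves without over/under information, away from vertices) and fork moves (moving an arc of an edge across a vertex). A perfect matching of $G$ is a set $M$ of edges such that each vertex is incident to exactly one edge in $M$ (matching edges have two distinct endpoints). A perfect matching graph $\Gamma_M$ is a ribbon graph with a perfect matching $M$ of its underlying graph; two are equivalent if they are equivalent as ribbon graphs and the induced isomorphism of underlying graphs preserves the perfect matchings. Trivalent: every vertex has degree 3. **Smoothings and states.** Draw a matching edge $e$ of a trivalent graph vertically, with the two other half-edges at its top vertex going up-left and up-right, and the two other half-edges at its bottom vertex going down-left and down-right. The 0-smoothing deletes $e$ and its endpoints and joins up-left with down-left and up-right with down-right; the 1-smoothing joins up-left with down-right and up-right with down-left (the strands cross). If $M=\{e_1,\dots,e_\ell\}$ and $\alpha\in\{0,1\}^\ell$, the state $\Gamma_\alpha$ is the collection of (immersed) circles obtained by applying the $\alpha_i$-smoothing at each $e_i$; $k_\alpha$ is its number of circles and $|\alpha|=\sum\alpha_i$. **Bracket.** $\langle\Gamma_M\rangle$ is determined by: $\langle\Gamma_M\rangle=A\langle\text{0-smoothing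 at }e\rangle+B\langle\text{1-smoothing at }e\rangle$ for each matching edge $e$; $\langle\text{circle}\rangle=C$; and $\langle\Gamma_1\sqcup\Gamma_2\rangle=\langle\Gamma_1\rangle\langle\Gamma_2\rangle$. **MTQFTs.** $R\mathbf{Mod}$ is the symmetric monoidal category of finite-rank free $R$-modules. $\mathbf{MCob}$ is the symmetric monoidal category whose objects are nonnegative integers (numbers of circles with fixed orientation) and whose morphisms are diffeomorphism classes of possibly nonorientable two-dimensional cobordisms; it is presented as a symmetric monoidal category by generators $\mu\colon2\to1$, $\eta\colon0\to1$, $\Delta\colon1\to2$, $\epsilon\colon1\to0$, $m\colon1\to1$ ($m$ is a cylinder connected-summed with $\mathbb{RP}^2$), with the relations of a commutative Frobenius algebra for $(\mu,\eta,\Delta,\epsilon)$ together with $\mu\circ(m\otimes1)=m\circ\mu=\mu\circ(1\otimes m)$ and $m^3=\mu\circ\Delta\circ m$. An MTQFT is a symmetric monoidal functor $\mathcal{F}\colon\mathbf{MCob}\to R\mathbf{Mod}$. **Gradings.** Write $g=g_1^{p_1}\cdots g_m^{p_m}$. Define $(V\{s\})_g=V_{g'}$ with $g'=g_1^{p_1-s_1}\cdots g_m^{p_m-s_m}$, and $q\mathrm{dim}(V)=\sum_{g}q_1^{p_1}\cdots q_m^{p_m}\dim(V_g)$, where the variables $q_i$ satisfy the same relations as the $g_i$ (so $q\mathrm{dim}$ lies in the group ring $\mathbb{Z}[\mathcal{G}]$). Tensor products carry the product grading. Each of $\mu_V,\Delta_V,m_V$ sends degree $g$ to degree $g\cdot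 g_1^{-s_1}\cdots g_m^{-s_m}$. Here $\dim$ is the rank on free modules; for a homology module over a domain $R$ it is the dimension after base change to the fraction field (for general $R$, any fixed isomorphism-invariant extension of the rank of free modules). **Complex and homology.** $V_\alpha=V^{\otimes k_\alpha}\{s|\alpha|\}$, with tensor factors indexed by the circles of $\Gamma_\alpha$ and $s|\alpha|=(s_1|\alpha|,\dots,s_m|\alpha|)$. Put $C^{i,*}(\Gamma_M)=\bigoplus_{|\alpha|=i}V_\alpha$ for $0\le i\le\ell$ and $0$ otherwise. If $\alpha'$ is obtained from $\alpha$ by changing one entry $0$ to $1$, then $\partial_{\alpha\alpha'}\colon V_\alpha\to V_{\alpha'}$ is $\mu_V$ if two circles merge, $\Delta_V$ if one circle splits into two, and $m_V$ if one circle is changed into one circle, on the affected tensor factors, and the identity on all other factors. For $v\in V_\alpha$, $\partial^i(v)=\sum_{\alpha'}(-1)^{f_{\alpha\alpha'}}\partial_{\alpha\alpha'}(v)$, where $f_{\alpha\alpha'}$ is the number of entries 1 to the left of the entry where $\alpha,\alpha'$ differ. The Möbius homology $MH^{i,g}(\Gamma_M;R)$ is the homology of $(C^{*,*}(\Gamma_M),\partial)$ in homological degree $i$ and $\mathcal{G}$-degree $g$. *)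

(* Defs.v *)
From HB Require Import structures.
From mathcomp Require Import all_boot all_algebra all_fingroup.
From mathcomp Require Import finmap.
From mathcomp Require Import generic_quotient ring_quotient.
From mathcomp Require Import boolp classical_sets fsbigop finset.
From mathcomp.multinomials Require Import monalg.

Set Implicit Arguments.
Unset Strict Implicit.
Unset Printing Implicit Defensive.

Import GRing.Theory.
Local Open Scope ring_scope.

(* The group ring Z[G] of an abelian group G, written additively. The product
   of {malg int[G]} in multinomials requires a monoid without units, so the
   convolution product is rebuilt here. *)

Definition group_ring (G : zmodType) : Type := {malg int[G]}.

HB.instance Definition _ (G : zmodType) := GRing.Zmodule.on (group_ring G).

(* The monomial q^g. With G generated by g_1, ..., g_m, the variable q_i is
   gmon (g_i), and q_1^p_1 ... q_m^p_m is gmon (p_1 g_1 + ... + p_m g_m). *)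
Definition gmon (G : zmodType) (g : G) : group_ring G := << 1 *g g >>.

Section GroupRing.
Variable G : zmodType.
Implicit Types x y z : group_ring G.

Definition gmul x y : group_ring G :=
  \sum_(k1 <- msupp x) \sum_(k2 <- msupp y) << x@_k1 * y@_k2 *g (k1 + k2) >>.

Lemma gmullw (d1 d2 : {fset G}) x y :
  (msupp x `<=` d1)%fset -> (msupp y `<=` d2)%fset ->
  gmul x y = \sum_(k1 <- d1) \sum_(k2 <- d2) << x@_k1 * y@_k2 *g (k1 + k2) >>.
Proof.
move=> le_d1 le_d2; rewrite /gmul (big_fset_incl _ le_d1) /=.
  apply/eq_bigr=> k1 _; apply/big_fset_incl => // k _ /mcoeff_outdom ->.
  by rewrite mulr0 monalgU0.
move=> k _ /mcoeff_outdom xk.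
by rewrite big1 => // k' _; rewrite xk mul0r monalgU0.
Qed.

Lemma gmulC : commutative gmul.
Proof.
move=> x y; rewrite /gmul exchange_big.
by apply: eq_bigr => k1 _; apply: eq_bigr => k2 _; rewrite mulrC [k2 + k1]addrC.
Qed.

Lemma gmul0x : left_zero 0 gmul.
Proof. by move=> x; rewrite /gmul msupp0 big_seq_fset0. Qed.

Lemma gmulUx c k x :
  gmul << c *g k >> x = \sum_(k' <- msupp x) << c * x@_k' *g k + k' >>.
Proof.
rewrite (gmullw msuppU_le (fsubset_refl _)) big_seq_fset1.
by apply/eq_bigr => k' _; rewrite mcoeffUU.
Qed.

Lemma gmulUU c1 c2 k1 k2 :
  gmul << c1 *g k1 >> << c2 *g k2 >> = << c1 * c2 *g k1 + k2 >>.
Proof. by rewrite (gmullw msuppU_le msuppU_le) !big_seq_fset1 !mcoeffUU. Qed.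

Lemma gmulDl : left_distributive gmul +%R.
Proof.
move=> x1 x2 y.
rewrite (gmullw (msuppD_le x1 x2) (fsubset_refl _)).
rewrite (gmullw (fsubsetUl (msupp x1) (msupp x2)) (fsubset_refl _)).
rewrite (gmullw (fsubsetUr (msupp x1) (msupp x2)) (fsubset_refl _)).
rewrite -big_split /=; apply/eq_bigr => k1 _.
rewrite -big_split /=; apply/eq_bigr => k2 _.
by rewrite mcoeffD mulrDl monalgUD.
Qed.

Lemma gmulDr : right_distributive gmul +%R.
Proof. by move=> x y1 y2; rewrite gmulC gmulDl ![gmul _ x]gmulC. Qed.

Lemma gmul1x : left_id (gmon 0) gmul.
Proof.
move=> x; rewrite gmulUx [RHS]monalgE.
by apply/eq_bigr=> k _; rewrite mul1r add0r.
Qed.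

Lemma gmulA : associative gmul.
Proof.
have gmulx0 : right_zero (0 : group_ring G) gmul by move=> x; rewrite gmulC gmul0x.
have El x y : gmul x y = \sum_(k <- msupp x) gmul << x@_k *g k >> y.
  by apply/eq_bigr => k _; rewrite gmulUx.
have Er x y : gmul x y = \sum_(k <- msupp y) gmul x << y@_k *g k >>.
  by rewrite gmulC El; apply/eq_bigr => k _; rewrite gmulC.
move=> x y z.
rewrite [RHS](big_morph (gmul^~ _) (fun _ _ => gmulDl _ _ _) (gmul0x _)).
rewrite El; apply/eq_bigr=> k1 _.
rewrite [LHS](big_morph (gmul _) (fun _ _ => gmulDr _ _ _) (gmulx0 _)).
rewrite [RHS](big_morph (gmul^~ _) (fun _ _ => gmulDl _ _ _) (gmul0x _)).
apply/eq_bigr=> k2 _.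
rewrite [LHS](big_morph (gmul _) (fun _ _ => gmulDr _ _ _) (gmulx0 _)).
by rewrite Er; apply/eq_bigr=> k3 _; rewrite !gmulUU mulrA addrA.
Qed.

Lemma gmon0_neq0 : gmon (0 : G) != 0.
Proof. by apply/eqP/malgP=> /(_ 0) /eqP; rewrite !mcoeffsE oner_eq0. Qed.

HB.instance Definition _ := GRing.Zmodule_isComNzRing.Build (group_ring G)
  gmulA gmulC gmul1x gmulDl gmon0_neq0.

End GroupRing.

Record submodule (R : comNzRingType) (U : lmodType R) := Submodule {
  sm_mem : U -> Prop;
  sm_mem0 : sm_mem 0;
  sm_memP : forall (a : R) u v, sm_mem u -> sm_mem v -> sm_mem (a *: u + v)
}.

Section Submodules.
Variables (R : comNzRingType) (U : lmodType R).

Definition sm_pred (W : submodule U) : {pred U} := fun u => `[< sm_mem W u >].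

Lemma sm_pred_closed W : submod_closed (sm_pred W).
Proof.
split=> [|a u v /asboolP Wu /asboolP Wv]; apply/asboolP; first exact: sm_mem0.
exact: sm_memP.
Qed.

HB.instance Definition _ (W : submodule U) :=
  GRing.isSubmodClosed.Build R U (sm_pred W) (sm_pred_closed W).

Record sub_mod (W : submodule U) : predArgType :=
  SubMod { sub_val : U; sub_valP : sub_val \in sm_pred W }.

HB.instance Definition _ (W : submodule U) := [isSub for @sub_val W].
HB.instance Definition _ (W : submodule U) := [Choice of sub_mod W by <:].
HB.instance Definition _ (W : submodule U) :=
  [SubChoice_isSubLmodule of sub_mod W by <:].

Definition quot_mod (W : submodule U) : Type :=
  Quotient.quot (sm_pred W : zmodClosed U).

HB.instance Definition _ (W : submodule U) := Choice.on (quot_mod W).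
HB.instance Definition _ (W : submodule U) := GRing.Zmodule.on (quot_mod W).

Section Scale.
Variable W : submodule U.
Local Notation Q := (Quotient.quot (sm_pred W : zmodClosed U)).
Local Open Scope quotient_scope.

Definition quot_scale (a : R) (x : quot_mod W) : quot_mod W :=
  \pi_Q (a *: repr (x : Q)).

Lemma quot_eqP (u v : U) : reflect (sm_mem W (u - v)) (\pi_Q u == \pi_Q v).
Proof.
rewrite -(Quotient.idealrBE (sm_pred W : zmodClosed U)).
by rewrite unfold_in; exact: asboolP.
Qed.

Lemma quot_scaleE a u : quot_scale a (\pi_Q u) = \pi_Q (a *: u).
Proof.
rewrite /quot_scale; apply/eqP/quot_eqP.
have /quot_eqP Wu : \pi_Q (repr (\pi_Q u)) == \pi_Q u by rewrite reprK.
by rewrite -scalerBr -[_ *: _]addr0; exact: sm_memP (sm_mem0 W).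
Qed.

Lemma quot_ex (x : quot_mod W) : exists u, x = \pi_Q u.
Proof. by exists (repr (x : Q)); rewrite reprK. Qed.

Lemma quot_piD u v :
  \pi_Q (u + v) = (\pi_Q u : quot_mod W) + (\pi_Q v : quot_mod W).
Proof. exact: Quotient.pi_add. Qed.

Lemma quot_scaleA a b x : quot_scale a (quot_scale b x) = quot_scale (a * b) x.
Proof. by have [u ->] := quot_ex x; rewrite !quot_scaleE scalerA. Qed.

Lemma quot_scale1 : left_id 1 quot_scale.
Proof. by move=> x; have [u ->] := quot_ex x; rewrite quot_scaleE scale1r. Qed.

Lemma quot_scaleDr : right_distributive quot_scale +%R.
Proof.
move=> a x y; have [u ->] := quot_ex x; have [v ->] := quot_ex y.
by rewrite -quot_piD !quot_scaleE scalerDr quot_piD.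
Qed.

Lemma quot_scaleDl x : {morph quot_scale^~ x : a b / a + b}.
Proof.
by move=> a b; have [u ->] := quot_ex x; rewrite !quot_scaleE scalerDl quot_piD.
Qed.

HB.instance Definition _ := GRing.Zmodule_isLmodule.Build R (quot_mod W)
  quot_scaleA quot_scale1 quot_scaleDr quot_scaleDl.

End Scale.

End Submodules.

Definition lmod_iso (R : comNzRingType) (U W : lmodType R) : Prop :=
  exists f : {linear U -> W}, bijective f.

(* A finite-rank free module is R^X with X a finite set, the tensor product of
   R^X and R^Y being R^(X * Y). tens_map f g is the tensor product of the maps f
   and g when these are linear. *)

Notation freemod R X := {ffun X -> R^o}.

Section FreeModules.
Variable R : comNzRingType.

Definition fdelta (X : finType) (x : X) : freemod R X := [ffun z => (z == x)%:R].

Definition mat_map (X Y : finType) (A : X -> Y -> R) (v : freemod R X) :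
  freemod R Y := [ffun y => \sum_x v x * A x y].

Definition tens_map (X X' Y Y' : finType) (f : freemod R X -> freemod R X')
  (g : freemod R Y -> freemod R Y') : freemod R (X * Y) -> freemod R (X' * Y') :=
  mat_map (fun p q => f (fdelta p.1) q.1 * g (fdelta p.2) q.2).

Lemma mat_map_is_linear (X Y : finType) (A : X -> Y -> R) : linear (mat_map A).
Proof.
move=> a u v; apply/ffunP => y; rewrite !ffunE scaler_sumr -big_split /=.
by apply: eq_bigr => x _; rewrite !ffunE mulrDl -[a *: _]/(a * _) -mulrA.
Qed.

HB.instance Definition _ (X Y : finType) (A : X -> Y -> R) :=
  GRing.isLinear.Build R (freemod R X) (freemod R Y) _ (mat_map A)
    (mat_map_is_linear A).

Definition reindex (X Y : finType) (h : Y -> X) (v : freemod R X) :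
  freemod R Y := [ffun y => v (h y)].

End FreeModules.

(* The category MCob, by its presentation as a strict symmetric monoidal
   category: a morphism a -> b is an element of cob a b modulo cob_eq. *)

Inductive cob : nat -> nat -> Type :=
| Cid n : cob n n
| Ccomp a b c : cob b c -> cob a b -> cob a c
| Ctens a b c d : cob a b -> cob c d -> cob (a + c) (b + d)
| Cswap a b : cob (a + b) (b + a)
| Cmu : cob 2 1
| Ceta : cob 0 1
| CDelta : cob 1 2
| Ceps : cob 1 0
| Cm : cob 1 1.

(* The identity between two equal objects: the strict associator or unitor. *)
Definition Ccast a b (e : a = b) : cob a b := ecast n (cob a n) e (Cid a).

Declare Scope cob_scope.
Delimit Scope cob_scope with cob.
Bind Scope cob_scope with cob.
Notation "f \; g" := (Ccomp g f) : cob_scope.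
Notation "f \ox g" := (Ctens f g) (at level 40, left associativity) : cob_scope.

Section CobEq.
Local Open Scope cob_scope.
Local Notation "1" := (Cid 1) : cob_scope.
Local Notation mu := Cmu.
Local Notation eta := Ceta.
Local Notation Delta := CDelta.
Local Notation eps := Ceps.
Local Notation m := Cm.
Local Unset Implicit Arguments.

Inductive cob_eq : forall a b : nat, cob a b -> cob a b -> Prop :=
| ceq_refl a b (f : cob a b) : cob_eq a b f f
| ceq_sym a b (f g : cob a b) : cob_eq a b f g -> cob_eq a b g f
| ceq_trans a b (f g h : cob a b) :
    cob_eq a b f g -> cob_eq a b g h -> cob_eq a b f h
| ceq_comp a b c (f f' : cob a b) (g g' : cob b c) :
    cob_eq a b f f' -> cob_eq b c g g' -> cob_eq a c (f \; g) (f' \; g')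
| ceq_tens a b c d (f f' : cob a b) (g g' : cob c d) :
    cob_eq a b f f' -> cob_eq c d g g' ->
    cob_eq (a + c) (b + d) (f \ox g) (f' \ox g')
| ceq_compA a b c d (f : cob a b) (g : cob b c) (h : cob c d) :
    cob_eq a d ((f \; g) \; h) (f \; (g \; h))
| ceq_idl a b (f : cob a b) : cob_eq a b (Cid a \; f) f
| ceq_idr a b (f : cob a b) : cob_eq a b (f \; Cid b) f
| ceq_tens_id a b : cob_eq (a + b) (a + b) (Cid a \ox Cid b) (Cid (a + b))
| ceq_interchange a b c a' b' c' (f : cob a b) (g : cob b c)
    (f' : cob a' b') (g' : cob b' c') :
    cob_eq (a + a') (c + c')
      ((f \; g) \ox (f' \; g')) ((f \ox f') \; (g \ox g'))
| ceq_tensA a a' b b' c c' (f : cob a a') (g : cob b b') (h : cob c c') :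
    cob_eq (a + (b + c)) (a' + b' + c')
      ((f \ox (g \ox h)) \; Ccast (addnA a' b' c'))
      (Ccast (addnA a b c) \; ((f \ox g) \ox h))
| ceq_tens0l a b (f : cob a b) : cob_eq a b (Cid 0 \ox f) f
| ceq_tens0r a b (f : cob a b) :
    cob_eq (a + 0) b ((f \ox Cid 0) \; Ccast (addn0 b)) (Ccast (addn0 a) \; f)
| ceq_swap_nat a b c d (f : cob a b) (g : cob c d) :
    cob_eq (a + c) (d + b) ((f \ox g) \; Cswap b d) (Cswap a c \; (g \ox f))
| ceq_swapK a b : cob_eq (a + b) (a + b) (Cswap a b \; Cswap b a) (Cid (a + b))
| ceq_hexagon a b c :
    cob_eq (a + (b + c)) (b + c + a)
      (Cswap a (b + c))
      (Ccast (addnA a b c) \; (Cswap a b \ox Cid c) \;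
       Ccast (esym (addnA b a c)) \; (Cid b \ox Cswap a c) \;
       Ccast (addnA b c a))
| ceq_muA : cob_eq 3 1 ((mu \ox 1) \; mu) ((1 \ox mu) \; mu)
| ceq_mu_etal : cob_eq 1 1 ((eta \ox 1) \; mu) 1
| ceq_mu_etar : cob_eq 1 1 ((1 \ox eta) \; mu) 1
| ceq_muC : cob_eq 2 1 (Cswap 1%N 1%N \; mu) mu
| ceq_DeltaA : cob_eq 1 3 (Delta \; (Delta \ox 1)) (Delta \; (1 \ox Delta))
| ceq_Delta_epsl : cob_eq 1 1 (Delta \; (eps \ox 1)) 1
| ceq_Delta_epsr : cob_eq 1 1 (Delta \; (1 \ox eps)) 1
| ceq_DeltaC : cob_eq 1 2 (Delta \; Cswap 1%N 1%N) Delta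
| ceq_frobl : cob_eq 2 2 ((1 \ox Delta) \; (mu \ox 1)) (mu \; Delta)
| ceq_frobr : cob_eq 2 2 ((Delta \ox 1) \; (1 \ox mu)) (mu \; Delta)
| ceq_ml : cob_eq 2 1 ((m \ox 1) \; mu) (mu \; m)
| ceq_mr : cob_eq 2 1 ((1 \ox m) \; mu) (mu \; m)
| ceq_m3 : cob_eq 1 1 (m \; m \; m) (m \; Delta \; mu).
End CobEq.

Arguments cob_eq {a b} f g.

(* A (strong) symmetric monoidal functor from MCob to finite-rank free
   R-modules: n is sent to R^(mt_obj n), and mt_phi (with inverse mt_psi) and
   mt_phi0 (with inverse mt_psi0) are the monoidal structure isomorphisms. *)
Record MTQFT (R : comNzRingType) := {
  mt_obj : nat -> finType;
  mt_hom : forall a b, cob a b ->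
    {linear freemod R (mt_obj a) -> freemod R (mt_obj b)};
  mt_phi : forall a b,
    {linear freemod R (mt_obj a * mt_obj b) -> freemod R (mt_obj (a + b))};
  mt_psi : forall a b,
    {linear freemod R (mt_obj (a + b)) -> freemod R (mt_obj a * mt_obj b)};
  mt_phi0 : {linear freemod R unit -> freemod R (mt_obj 0)};
  mt_psi0 : {linear freemod R (mt_obj 0) -> freemod R unit};
  mt_hom_eq : forall a b (f g : cob a b), cob_eq f g -> mt_hom f =1 mt_hom g;
  mt_hom_id : forall a v, mt_hom (Cid a) v = v;
  mt_hom_comp : forall a b c (g : cob b c) (f : cob a b) v,
    mt_hom (Ccomp g f) v = mt_hom g (mt_hom f v);
  mt_phiK : forall a b, cancel (mt_phi a b) (mt_psi a b);
  mt_psiK : forall a b, cancel (mt_psi a b) (mt_phi a b);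
  mt_phi0K : cancel mt_phi0 mt_psi0;
  mt_psi0K : cancel mt_psi0 mt_phi0;
  mt_natural : forall a b c d (f : cob a b) (g : cob c d) v,
    mt_hom (Ctens f g) (mt_phi a c v) =
    mt_phi b d (tens_map (mt_hom f) (mt_hom g) v);
  mt_assoc : forall a b c v,
    mt_hom (Ccast (addnA a b c)) (mt_phi a (b + c) (tens_map id (mt_phi b c) v)) =
    mt_phi (a + b) c (tens_map (mt_phi a b) id
      (reindex (fun p : (mt_obj a * mt_obj b) * mt_obj c =>
                  (p.1.1, (p.1.2, p.2))) v));
  mt_unitl : forall a v,
    mt_phi 0 a (tens_map mt_phi0 id v) = reindex (fun x : mt_obj a => (tt, x)) v;
  mt_unitr : forall a v,
    mt_hom (Ccast (addn0 a)) (mt_phi a 0 (tens_map id mt_phi0 v)) =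
    reindex (fun x : mt_obj a => (x, tt)) v;
  mt_sym : forall a b v,
    mt_hom (Cswap a b) (mt_phi a b v) =
    mt_phi b a (reindex (fun p : mt_obj b * mt_obj a => (p.2, p.1)) v)
}.

Section MTQFTData.
Variables (R : comNzRingType) (F : MTQFT R).

(* V = F(1) is R^(mt_basis F). *)
Definition mt_basis : finType := mt_obj F 1.
Local Notation X := mt_basis.

Definition mt_mu (v : freemod R (X * X)) : freemod R X :=
  mt_hom F Cmu (mt_phi F 1 1 v).
Definition mt_Delta (v : freemod R X) : freemod R (X * X) :=
  mt_psi F 1 1 (mt_hom F CDelta v).
Definition mt_m (v : freemod R X) : freemod R X := mt_hom F Cm v.

End MTQFTData.

Arguments mt_mu {R} F v.
Arguments mt_Delta {R} F v.
Arguments mt_m {R} F v.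

(* Gradings. A finite-rank free module graded by finite-rank free submodules is
   R^X = (+)_g R^(X_g) with X the disjoint union of finite sets X_g, i.e. with
   a degree attached to each element of X; graded_piece deg g is R^(X_g). *)

Section Graded.
Variables (R : comNzRingType) (X : finType) (D : eqType) (deg : X -> D) (g : D).

Definition homogeneous (v : freemod R X) : Prop :=
  forall x, v x != 0 -> deg x = g.

Lemma homogeneous0 : homogeneous 0.
Proof. by move=> x; rewrite ffunE eqxx. Qed.

Lemma homogeneousP (a : R) u v :
  homogeneous u -> homogeneous v -> homogeneous (a *: u + v).
Proof.
move=> hu hv x; have [u0 | /hu //] := eqVneq (u x) 0.
have [v0 | /hv //] := eqVneq (v x) 0.
by rewrite !ffunE u0 v0 scaler0 addr0 eqxx.
Qed.

Definition graded_piece : submodule (freemod R X) :=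
  Submodule homogeneous0 homogeneousP.

End Graded.

Section QDim.
Variables (R : comNzRingType) (G : zmodType).

(* An isomorphism-invariant extension of the rank of free modules. *)
Definition extends_rank (dim : lmodType R -> int) : Prop :=
  (forall U W : lmodType R, lmod_iso U W -> dim U = dim W) /\
  (forall n : nat, dim 'rV[R]_n = n%:Z).

Definition qdim (dim : lmodType R -> int) (W : G -> lmodType R) : group_ring G :=
  \sum_(g \in @classical_sets.setT G) gmon g *~ dim (W g).

End QDim.

(* Ribbon graphs, as graphs with a cyclic order of the half-edges at each
   vertex: rg_next is the counterclockwise successor around a vertex and rg_opp
   exchanges the two halves of an edge. *)
Record ribbon_graph := RibbonGraph {
  rg_half :> finType;
  rg_next : {perm rg_half};
  rg_opp : {perm rg_half};
  rg_opp_inv : forall h, rg_opp (rg_opp h) = h;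
  rg_opp_free : forall h, rg_opp h != h;
  rg_connected : forall h k,
    connect (fun x y => (y == rg_next x) || (y == rg_opp x)) h k;
  rg_nonempty : (0 < #|rg_half|)%N
}.

Definition rg_vertices (G : ribbon_graph) : {set {set G}} := porbits (rg_next G).
Definition rg_edges (G : ribbon_graph) : {set {set G}} := porbits (rg_opp G).

Definition trivalent (G : ribbon_graph) : Prop :=
  forall v, v \in rg_vertices G -> #|v| = 3.

Definition perfect_matching (G : ribbon_graph) (M : {set {set G}}) : Prop :=
  [/\ M \subset rg_edges G,
      forall e v, e \in M -> v \in rg_vertices G -> (#|e :&: v| <= 1)%N
    & forall v, v \in rg_vertices G -> #|[set e in M | ~~ [disjoint e & v]]| = 1].

Record pm_graph := PMGraph {
  pm_rg :> ribbon_graph;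
  pm_match : {set {set pm_rg}};
  pm_perfect : perfect_matching pm_match
}.

Definition pm_equiv (P P' : pm_graph) : Prop :=
  exists phi : P -> P',
    [/\ bijective phi,
        forall h, phi (rg_next P h) = rg_next P' (phi h),
        forall h, phi (rg_opp P h) = rg_opp P' (phi h)
      & pm_match P' = [set [set phi h | h in (e : {set P})] | e in pm_match P]].

(* Partially smoothed graphs. Smoothing a matching edge deletes its two
   half-edges, and replaces each of its two end vertices by nothing: the
   half-edges x and y that are joined become the two sides of a bivalent point
   of an arc, recorded by dg_next x = y and dg_next y = x. Such points are not
   vertices; a circle is a connected diagram all of whose points are of this
   kind. dg_next and dg_opp are only meaningful on dg_half. *)

Record diagram (T : finType) := Diagram {
  dg_half : {set T};
  dg_next : T -> T;
  dg_opp : T -> T;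
  dg_match : {set {set T}}
}.

Definition diagram_of (P : pm_graph) : diagram P :=
  Diagram [set: P] (rg_next P) (rg_opp P) (pm_match P).

Section Diagrams.
Variable T : finType.
Implicit Types (D : diagram T) (S : {set {set T}}) (e : {set T}).

(* Let a, b be the halves of a vertical matching edge at its top and bottom
   vertex. Counterclockwise from the edge, the other half-edges are up-right
   = next a and up-left = next (next a) at the top, and down-left = next b and
   down-right = next (next b) at the bottom. The 0-smoothing joins next (next a)
   with next b and next a with next (next b); the 1-smoothing joins
   next (next a) with next (next b) and next a with next b. The rule is
   invariant under the exchange of a and b. The vertices being trivalent, a is
   next (next h) if h = next a, and next h if h = next (next a). *)
Definition smooth_next D S (b : {set T} -> bool) (h : T) : T :=
  let next := dg_next D in
  let opp := dg_opp D in
  let edge a := [set a; opp a] in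
  if next (next h) \in cover S then
    let a := next (next h) in
    if b (edge a) then next (opp a) else next (next (opp a))
  else if next h \in cover S then
    let a := next h in
    if b (edge a) then next (next (opp a)) else next (opp a)
  else next h.

(* Apply the b(e)-smoothing at each edge e in S. *)
Definition smoothing D S b : diagram T :=
  Diagram (dg_half D :\: cover S) (smooth_next D S b) (dg_opp D)
    (dg_match D :\: S).

Definition dg_adj D : rel T := fun x y => (y == dg_next D x) || (y == dg_opp D x).

Definition components D : {set {set T}} :=
  [set [set y | connect (dg_adj D) x y] | x in dg_half D].

Definition is_circle D : Prop :=
  #|components D| = 1 /\
  forall h, h \in dg_half D ->
    dg_next D h != h /\ dg_next D (dg_next D h) = h.

Definition restrict D (N : {set T}) : diagram T :=
  Diagram N (dg_next D) (dg_opp D) [set e in dg_match D | e \subset N].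

(* The value of the bracket, as determined by its three rules. *)
Inductive bracket (K : comNzRingType) (A B C : K) : diagram T -> K -> Prop :=
| bracket_edge D e x y :
    e \in dg_match D ->
    bracket A B C (smoothing D [set e] (fun=> false)) x ->
    bracket A B C (smoothing D [set e] (fun=> true)) y ->
    bracket A B C D (A * x + B * y)
| bracket_circle D : is_circle D -> bracket A B C D C
| bracket_union D (N : {set T}) x y :
    N \subset dg_half D ->
    (forall h, h \in dg_half D -> (dg_next D h \in N) = (h \in N)) ->
    (forall h, h \in dg_half D -> (dg_opp D h \in N) = (h \in N)) ->
    bracket A B C (restrict D N) x ->
    bracket A B C (restrict D (dg_half D :\: N)) y ->
    bracket A B C D (x * y).

End Diagrams.

Section MoebiusComplex.
Variables (R : comNzRingType) (F : MTQFT R) (G : zmodType).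
(* deg grades V = F(1); shift is s_1 g_1 + ... + s_m g_m. *)
Variables (deg : mt_basis F -> G) (shift : G).
Variable (P : pm_graph).
Local Notation M := (pm_match P).
Local Notation X := (mt_basis F).

(* {0,1}^l, a state being identified with the set of 1-smoothed edges; then
   |alpha| is the cardinal. *)
Definition state : finType := {a : {set {set P}} | a \subset M}.

Definition state_diagram (a : state) : diagram P :=
  smoothing (diagram_of P) M (fun e => e \in val a).

Definition circle (a : state) : finType :=
  {c : {set P} | c \in components (state_diagram a)}.

(* The tensor power of V = R^X with factors indexed by the circles of a state a
   is R^(circle a -> X); cx_basis indexes the basis of the sum of all V_a. *)
Definition cx_basis : finType := {a : state & {ffun circle a -> X}}.

Definition hdeg (b : cx_basis) : nat := #|val (tag b)|.
Definition gdeg (b : cx_basis) : G :=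
  \sum_(c : circle (tag b)) deg (tagged b c) + shift *+ hdeg b.
Definition bideg (b : cx_basis) : nat * G := (hdeg b, gdeg b).

Definition cx : lmodType R := freemod R cx_basis.

Definition cx_piece (i : nat) (g : G) : lmodType R :=
  sub_mod (graded_piece R bideg (i, g)).

(* The four half-edges adjacent to e; the circles affected by changing the
   smoothing at e are those through one of them. *)
Definition site (e : {set P}) : {set P} :=
  [set h | (h \notin e) && ~~ [disjoint porbit (rg_next P) h & e]].

Definition affected (e : {set P}) (a : state) : pred (circle a) :=
  fun c => ~~ [disjoint val c & site e].

(* Matrix entry, at the basis vectors f of V_alpha and f' of V_alpha', of the
   map that is mu, Delta or m on the factors affected by e and the identity on
   the others. *)
Definition edge_entry (e : {set P}) (a a' : state)
    (f : {ffun circle a -> X}) (f' : {ffun circle a' -> X}) : R :=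
  if [forall c, forall c', (val c == val c') && ~~ affected e c ==> (f c == f' c')]
  then
    match enum (@affected e a), enum (@affected e a') with
    | [:: c1; c2], [:: c'] => mt_mu F (fdelta R (f c1, f c2)) (f' c')
    | [:: c], [:: c1'; c2'] => mt_Delta F (fdelta R (f c)) (f' c1', f' c2')
    | [:: c], [:: c'] => mt_m F (fdelta R (f c)) (f' c')
    | _, _ => 0
    end
  else 0.

(* The ordering e_1, ..., e_l of the matching edges. *)
Variable ord : seq {set P}.

Definition diff_entry (b b' : cx_basis) : R :=
  \sum_(e in M | (e \notin val (tag b)) && (val (tag b') == e |: val (tag b)))
    (-1) ^+ #|[set e' in val (tag b) | (index e' ord < index e ord)%N]| *
    edge_entry e (tagged b) (tagged b').

Definition diff : {linear cx -> cx} := mat_map diff_entry.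

Section Homology.
Variables (i : nat) (g : G).

Definition cycle_mem (v : cx) : Prop := homogeneous bideg (i, g) v /\ diff v = 0.

Lemma cycle_mem0 : cycle_mem 0.
Proof. by split; [exact: homogeneous0 | rewrite linear0]. Qed.

Lemma cycle_memP (a : R) u v :
  cycle_mem u -> cycle_mem v -> cycle_mem (a *: u + v).
Proof.
move=> [hu du] [hv dv]; split; first exact: homogeneousP.
by rewrite linearP du dv scaler0 addr0.
Qed.

Definition cycles : submodule cx := Submodule cycle_mem0 cycle_memP.

(* Images of the elements w of C^{i-1,g}. *)
Definition boundary_mem (z : sub_mod cycles) : Prop :=
  exists2 w : cx, homogeneous (fun b => ((hdeg b).+1, gdeg b)) (i, g) w
                & diff w = val z.

Lemma boundary_mem0 : boundary_mem 0.
Proof. by exists 0; [exact: homogeneous0 | rewrite !linear0]. Qed.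

Lemma boundary_memP (a : R) y z :
  boundary_mem y -> boundary_mem z -> boundary_mem (a *: y + z).
Proof.
move=> [u hu du] [v hv dv]; exists (a *: u + v); first exact: homogeneousP.
by rewrite !linearP du dv.
Qed.

Definition boundaries : submodule (sub_mod cycles) :=
  Submodule boundary_mem0 boundary_memP.

Definition moebius_homology : lmodType R := quot_mod boundaries.

End Homology.

Variable dim : lmodType R -> int.

Definition poincare : {poly group_ring G} :=
  \sum_(i < #|M|.+1) qdim dim (moebius_homology i) *: 'X^i.

Definition euler_char : group_ring G :=
  \sum_(i < #|M|.+1) (-1) ^+ i * qdim dim (cx_piece i).

End MoebiusComplex.

(* Main.v *)
(* (1) An isomorphism of perfect matching graphs induces a bijection of states and
   of circles, hence of the bases of the two complexes, under which the matrices
   of the edge maps agree because mu is commutative and Delta cocommutative. The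
   signs of the two differentials are matched by rescaling V_alpha by the parity
   of the number of pairs of edges of alpha on which the two edge orders
   disagree; the result is an isomorphism of complexes preserving the bidegree.

   (2) The three rules of the bracket determine the state sum
   sum_alpha A^(l - |alpha|) B^|alpha| C^k_alpha, and the rank of V_alpha in
   each degree is read off its homogeneous basis. *)

From HB Require Import structures.
Require Import Defs.
From mathcomp Require Import boolp classical_sets fsbigop.
From mathcomp Require Import all_fingroup generic_quotient ring_quotient.
From mathcomp Require Import all_boot all_algebra.

Set Implicit Arguments.
Unset Strict Implicit.
Unset Printing Implicit Defensive.

Import GRing.Theory.
Local Open Scope ring_scope.

(** * Smoothings of diagrams *)

Section Diagrams.
Variable T : finType.
Implicit Types (D : diagram T) (S : {set {set T}}) (e : {set T}) (h a : T).

(** The bracket is a relation whose rules may be applied in any order, so its value has to be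
    compared with the state sum on every intermediate diagram, partly smoothed or restricted. There
    [dg_next] and [dg_opp] carry arbitrary values off [dg_half]. The predicate [good] keeps what
    survives: each half-edge lies at a bivalent point or at a trivalent vertex with exactly one
    matching half-edge. Uniqueness of the value is then an induction on the derivation, and
    existence an induction on the number of half-edges, restricted to nonempty diagrams because the
    rules give the empty one no value. In homology the obstacle is dependence: circles are sets of
    half-edges, listed in an order that an isomorphism need not respect, and tensor factors are
    indexed by types depending on the state. Edge maps are therefore compared through lists of
    labels up to permutation, and basis elements through the underlying sets of their circles. *)

Definition bivalent D h : Prop :=
  [/\ dg_next D h != h, dg_next D (dg_next D h) = h,
      h \notin cover (dg_match D) & dg_next D h \notin cover (dg_match D)].

Definition matched D a : Prop :=
  [/\ a \in dg_half D, a \in cover (dg_match D),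
      dg_next D (dg_next D (dg_next D a)) = a,
      dg_next D a \notin cover (dg_match D)
    & dg_next D (dg_next D a) \notin cover (dg_match D)].

(** The inductive invariant: a smoothing turns the two ends of an edge into bivalent points and
    leaves every other vertex alone. All conditions are relative to [dg_half], since smoothing and
    restriction shrink that set while the maps remain total. *)
Record good D : Prop := Good {
  good_next : forall h, h \in dg_half D -> dg_next D h \in dg_half D;
  good_opp : forall h, h \in dg_half D -> dg_opp D h \in dg_half D;
  good_oppK : forall h, h \in dg_half D -> dg_opp D (dg_opp D h) = h;
  good_opp_neq : forall h, h \in dg_half D -> dg_opp D h != h;
  good_match : forall e, e \in dg_match D ->
    exists2 a, a \in dg_half D & e = [set a; dg_opp D a];
  good_vertex : forall h, h \in dg_half D -> bivalent D h \/
    exists2 a, matched D a & h \in [:: a; dg_next D a; dg_next D (dg_next D a)]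
}.

Section Good.
Variables (D : diagram T) (gD : good D).
Local Notation next := (dg_next D).
Local Notation opp := (dg_opp D).
Local Notation M := (dg_match D).
Local Notation H := (dg_half D).

Lemma match_edge e a : e \in M -> a \in e -> e = [set a; opp a] /\ a \in H.
Proof.
move=> /(good_match gD) [x Hx ->]; rewrite !inE => /orP[]/eqP-> //.
by rewrite good_oppK // setUC; split=> //; exact: good_opp.
Qed.

(** Either half of a matching edge determines it as [[set a; opp a]], so distinct matching edges are
    disjoint and membership in a cover is a test on a single edge. *)
Lemma mem_cover_match S a : S \subset M ->
  reflect (a \in H /\ [set a; opp a] \in S) (a \in cover S).
Proof.
move=> sSM; apply: (iffP bigcupP) => [[e eS ae]|[Ha aS]].
  by have [<- Ha] := match_edge (subsetP sSM _ eS) ae.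
by exists [set a; opp a] => //; rewrite set21.
Qed.

Lemma cover_match_half : {subset cover M <= H}.
Proof. by move=> a /(mem_cover_match _ (subxx M)) []. Qed.

Lemma edge_opp a : a \in H -> [set opp a; opp (opp a)] = [set a; opp a].
Proof. by move=> Ha; rewrite good_oppK // setUC. Qed.

Lemma cover_opp S a : S \subset M -> a \in H ->
  (opp a \in cover S) = (a \in cover S).
Proof.
move=> sSM Ha; apply/(mem_cover_match _ sSM)/(mem_cover_match _ sSM);
  rewrite edge_opp //; last by case=> _; split=> //; exact: good_opp.
by case.
Qed.

Lemma cover_matchD S S' a : S \subset M -> S' \subset M ->
  (a \in cover (S :\: S')) = (a \in cover S) && (a \notin cover S').
Proof.
move=> sSM sSM'; have sDM : S :\: S' \subset M := subset_trans (subsetDl _ _) sSM.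
apply/(mem_cover_match _ sDM)/andP.
  rewrite inE => -[Ha /andP[aS' aS]]; split; first exact/mem_cover_match.
  by apply/negP => /(mem_cover_match _ sSM') [] _ /(negP aS').
case=> /(mem_cover_match _ sSM) [Ha aS] aS'; split=> //; rewrite inE aS andbT.
by apply: contra aS' => aS'; apply/mem_cover_match.
Qed.

Lemma cover_sub S a : S \subset M -> a \notin cover M -> a \notin cover S.
Proof.
move=> sSM; apply: contra => /(mem_cover_match _ sSM) [Ha aS].
by apply/(mem_cover_match _ (subxx M)); split=> //; exact: (subsetP sSM).
Qed.

Lemma matched_cover a : a \in cover M -> matched D a.
Proof.
move=> Ma; have [[_ _ /negP]//|[x mx]] := good_vertex gD (cover_match_half Ma).
case: (mx) => _ _ _ /negP n1 /negP n2; rewrite !inE.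
by case/or3P => /eqP ax; rewrite ax // in Ma *.
Qed.

Lemma matched_opp a : matched D a -> matched D (opp a).
Proof. by case=> Ha Ma _ _ _; apply: matched_cover; rewrite cover_opp. Qed.

Lemma bivalent_next h : bivalent D h -> bivalent D (next h).
Proof. by move=> [h1 h2 h3 h4]; split; rewrite // h2 // eq_sym. Qed.

Section Smoothing.
Variables (S : {set {set T}}) (b : {set T} -> bool) (sSM : S \subset M).
Local Notation snext := (smooth_next D S b).

Lemma smooth_next_bivalent h : bivalent D h -> snext h = next h.
Proof.
case=> [_ h2 h3 h4].
by rewrite /smooth_next h2 !ifN //; exact: cover_sub.
Qed.

Lemma smooth_next_unmatched a : matched D a -> a \notin cover S ->
  {in [:: a; next a; next (next a)], snext =1 next}.
Proof.
case=> [_ _ a3 /(cover_sub sSM) a1 /(cover_sub sSM) a2] aS h.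
by rewrite !inE /smooth_next => /or3P[] /eqP->; rewrite ?a3 !ifN.
Qed.

Lemma smooth_next1 a : matched D a -> a \in cover S ->
  snext (next a) =
    if b [set a; opp a] then next (opp a) else next (next (opp a)).
Proof. by case=> [_ _ a3 _ _] aS; rewrite /smooth_next a3 aS. Qed.

Lemma smooth_next2 a : matched D a -> a \in cover S ->
  snext (next (next a)) =
    if b [set a; opp a] then next (next (opp a)) else next (opp a).
Proof.
case=> [_ _ a3 a1 _] aS.
by rewrite /smooth_next a3 ifN ?aS //; exact: cover_sub.
Qed.

Lemma smooth_half h : h \in H :\: cover S ->
  [\/ bivalent D h,
      exists a, [/\ matched D a, a \notin cover S
                  & h \in [:: a; next a; next (next a)]]
    | exists a, [/\ matched D a, a \in cover S & h = next a \/ h = next (next a)]].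
Proof.
rewrite inE => /andP[hS Hh].
case: (good_vertex gD Hh) => [?|[a ma ha]]; first by constructor 1.
case: (boolP (a \in cover S)) => aS; last by constructor 2; exists a.
constructor 3; exists a; split=> //; move: ha; rewrite !inE.
case/or3P => /eqP ha; [by rewrite ha aS in hS|by left|by right].
Qed.

(** The two ends of a matching edge are different vertices: as [next] cubed fixes matched halves, a
    coincidence would identify [opp a] with [a] or with the unmatched half [next (next a)]. *)
Lemma matched_next_neq a : matched D a ->
  next (opp a) != next a /\ next (next (opp a)) != next a.
Proof.
move=> ma; have [Ha Ma a3 a1 a2] := ma.
have [Hb Mb b3 b1 b2] := matched_opp ma; split; apply/eqP => E.
  by move: (good_opp_neq gD Ha); rewrite -b3 E a3 eqxx.
by rewrite -E b3 in a2; rewrite Mb in a2.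
Qed.

(** Either smoothing pairs the two free halves at one end with the two at the other. The edge, hence
    the value of [b], is the same seen from [a] or from [opp a], so a second step undoes the
    first. *)
Lemma smooth_bivalent a h : matched D a -> a \in cover S ->
  h = next a \/ h = next (next a) ->
  [/\ snext h \in H :\: cover S, snext h != h & snext (snext h) = h].
Proof.
move=> ma aS; have mb := matched_opp ma.
have [Ha _ a3 /(cover_sub sSM) a1 /(cover_sub sSM) a2] := ma.
have [_ _ b3 /(cover_sub sSM) b1 /(cover_sub sSM) b2] := mb.
have bS : opp a \in cover S by rewrite cover_opp.
have Hb := good_opp gD Ha.
have [n1 n2] := matched_next_neq ma; have [n3 n4] := matched_next_neq mb.
rewrite good_oppK // in n3 n4.
have n5 : next (next (opp a)) != next (next a).
  by apply: contra n1 => /eqP E; rewrite -[opp a]b3 E a3.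
have Hn x : x \in H -> next x \in H by exact: good_next.
have [e1 e2] := (smooth_next1 ma aS, smooth_next2 ma aS).
have [e3 e4] := (smooth_next1 mb bS, smooth_next2 mb bS).
rewrite edge_opp // good_oppK // in e3 e4.
case: (b _) in e1 e2 e3 e4 *; move=> [] ->; rewrite ?e1 ?e2 ?e3 ?e4;
  by split=> //; rewrite ?[_ \in _ :\: _]inE ?b1 ?b2 ?Hn ?Hn // eq_sym.
Qed.

Lemma smoothing_cover a :
  a \notin cover M -> a \notin cover (dg_match (smoothing D S b)).
Proof. exact: (cover_sub (subsetDl _ _)). Qed.

Lemma smoothing_bivalent h : bivalent D h -> bivalent (smoothing D S b) h.
Proof.
move=> bh; rewrite /bivalent /= !smooth_next_bivalent //; last first.
  exact: bivalent_next.
by case: bh => [h1 h2 /smoothing_cover h3 /smoothing_cover h4].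
Qed.

Lemma smoothing_next_matched a : matched D a -> a \notin cover S ->
  [/\ snext a = next a, snext (next a) = next (next a)
    & snext (next (next a)) = a].
Proof.
move=> ma aS; have E := smooth_next_unmatched ma aS.
have [_ _ a3 _ _] := ma.
by split; rewrite E ?inE ?eqxx ?orbT.
Qed.

Lemma smoothing_matched a : matched D a -> a \notin cover S ->
  matched (smoothing D S b) a.
Proof.
move=> ma aS; have [E0 E1 E2] := smoothing_next_matched ma aS.
have [Ha Ma _ /smoothing_cover a1 /smoothing_cover a2] := ma.
by split=> //=; rewrite ?E0 ?E1 ?E2 // ?cover_matchD ?Ma // inE aS.
Qed.

Lemma smoothing_site a h : matched D a -> a \in cover S ->
  h = next a \/ h = next (next a) -> bivalent (smoothing D S b) h.
Proof.
move=> ma aS ha; have [_ h2 h3] := smooth_bivalent ma aS ha.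
split=> //=; apply: smoothing_cover.
  by case: ma ha => _ _ _ a1 a2 [] ->.
have [_ _ _ b1 b2] := matched_opp ma.
by case: ha => ->; rewrite ?(smooth_next1 ma aS) ?(smooth_next2 ma aS);
  case: (b _).
Qed.

Lemma good_smoothing : good (smoothing D S b).
Proof.
have HS a : a \notin cover M -> a \in H -> a \in H :\: cover S.
  by move=> aM Ha; rewrite inE Ha andbT; exact: cover_sub.
split=> /=.
- move=> h hh; have Hh : h \in H by move: hh; rewrite inE => /andP[].
  case: (smooth_half hh) => [bh|[a [ma aS ha]]|[a [ma aS ha]]].
  + rewrite smooth_next_bivalent //; case: bh => _ _ _ h4.
    by apply: HS => //; exact: good_next.
  + have [E0 E1 E2] := smoothing_next_matched ma aS.
    case: ma => Ha Ma a3 a1 a2; move: ha; rewrite !inE => /or3P[] /eqP->.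
    * by rewrite E0 (cover_sub sSM) ?good_next.
    * by rewrite E1 (cover_sub sSM) ?good_next ?good_next.
    * by rewrite E2 aS.
  + by have [] := smooth_bivalent ma aS ha.
- by move=> h; rewrite !inE => /andP[hS Hh]; rewrite cover_opp // hS good_opp.
- by move=> h; rewrite !inE => /andP[hS Hh]; rewrite good_oppK.
- by move=> h; rewrite !inE => /andP[hS Hh]; rewrite good_opp_neq.
- move=> e; rewrite inE => /andP[eS eM].
  have [a Ha E] := good_match gD eM; exists a => //; rewrite inE Ha andbT.
  by apply/(mem_cover_match _ sSM) => -[_]; rewrite -E (negPf eS).
move=> h hh; case: (smooth_half hh) => [bh|[a [ma aS ha]]|[a [ma aS ha]]].
- by left; exact: smoothing_bivalent.
- right; exists a; first exact: smoothing_matched.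
  by have [E0 E1 _] := smoothing_next_matched ma aS; rewrite /= E0 E1.
- by left; exact: smoothing_site ma aS ha.
Qed.

End Smoothing.
End Good.
End Diagrams.

(** * The bracket as a state sum *)

(** Follows a path inside a closed set while exchanging the relation; with a trivial [e'] it merely
    confines the path. *)
Lemma connect_closed (T : finType) (e e' : rel T) (H : {set T}) x y :
  (forall x y, x \in H -> e x y -> y \in H /\ e' x y) ->
  x \in H -> connect e x y -> y \in H /\ connect e' x y.
Proof.
move=> He Hx /connectP[p]; elim: p x Hx => [|z p IHp] x Hx /=; first by move=> _ ->.
move=> /andP[/(He _ _ Hx) [Hz xz] zp] /(IHp _ Hz zp) [Hy zy].
by split=> //; exact: connect_trans (connect1 xz) zy.
Qed.

Section PowersetSums.
Variables (T : finType) (K : nmodType).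
Implicit Types (F : {set T} -> K) (M : {set T}).

Lemma sum_powersetD1 F M e : e \in M ->
  \sum_(x in powerset M) F x = \sum_(x in powerset (M :\ e)) (F x + F (e |: x)).
Proof.
move=> eM; rewrite (bigID (fun x : {set T} => e \notin x)) big_split /=.
congr (_ + _); first by apply: eq_bigl => x; rewrite !inE subsetD1.
rewrite (reindex_onto (fun x => e |: x) (fun x => x :\ e)) /=; last first.
  by move=> x; rewrite negbK => /andP[_ ex]; rewrite setD1K.
apply: eq_bigl => x; rewrite !inE eqxx /= subUset sub1set eM andbT subsetD1.
by congr (_ && _); apply/eqP/idP => [<-|ex]; rewrite ?setD11 ?setU1K.
Qed.

Lemma sum_powersetU F (M1 M2 : {set T}) : [disjoint M1 & M2] ->
  \sum_(x in powerset (M1 :|: M2)) F x =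
  \sum_(x in powerset M1) \sum_(y in powerset M2) F (x :|: y).
Proof.
move=> dM; rewrite pair_big /=.
rewrite (reindex_onto (fun p : {set T} * {set T} => p.1 :|: p.2)
           (fun x => (x :&: M1, x :&: M2))) /=; last first.
  by move=> x; rewrite inE -setIUr => /setIidPl.
apply: eq_bigl => -[x y]; rewrite !inE /= !setIUl.
apply/andP/andP => [[_ /eqP[<- <-]]|[xM yM]].
  by rewrite -!setIUl !subsetIr.
split; first exact: setUSS.
have d1 : y :&: M1 = set0.
  by apply/eqP; rewrite setI_eq0 disjoint_sym; exact: disjointWr dM.
have d2 : x :&: M2 = set0 by apply/eqP; rewrite setI_eq0; exact: disjointWl dM.
by rewrite d1 d2 setU0 set0U (setIidPl xM) (setIidPl yM).
Qed.
End PowersetSums.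

Section StateSum.
Variables (T : finType) (K : comNzRingType) (A B C : K).
Implicit Types (D : diagram T) (N : {set T}).

Lemma components_eq D D' : good D -> dg_half D = dg_half D' ->
  {in dg_half D, dg_next D =1 dg_next D'} ->
  {in dg_half D, dg_opp D =1 dg_opp D'} -> components D = components D'.
Proof.
move=> gD EH En Eo; rewrite /components -EH; apply: eq_in_imset => h Hh.
have step a b : a \in dg_half D -> dg_adj D a b -> b \in dg_half D /\ dg_adj D' a b.
  move=> Ha; rewrite /dg_adj -En // -Eo // => ab; split=> //.
  by case/orP: ab => /eqP->; [exact: good_next | exact: good_opp].
have step' a b : a \in dg_half D -> dg_adj D' a b -> b \in dg_half D /\ dg_adj D a b.
  move=> Ha; rewrite /dg_adj -En // -Eo // => ab; split=> //.
  by case/orP: ab => /eqP->; [exact: good_next | exact: good_opp].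
apply/setP => k; rewrite !inE.
by apply/idP/idP => hk; [have [] := connect_closed step Hh hk
                        | have [] := connect_closed step' Hh hk].
Qed.

(** The side conditions of [bracket_union]. Being equalities, they make both [N] and its complement
    in [dg_half] closed under the two maps. *)
Definition stable D N : Prop :=
  [/\ N \subset dg_half D,
      forall h, h \in dg_half D -> (dg_next D h \in N) = (h \in N)
    & forall h, h \in dg_half D -> (dg_opp D h \in N) = (h \in N)].

(** Restriction keeps the maps, so the components of [D] are merely sorted by starting point; none
    is counted twice because a path from [N] stays in [N]. *)
Lemma card_components_restrict D N : stable D N ->
  #|components D| = (#|components (restrict D N)| +
                     #|components (restrict D (dg_half D :\: N))|)%N.
Proof.
case=> sND nN oN.
rewrite /components /= -[in LHS](setID (dg_half D) N) imsetU.
rewrite (setIidPr sND) cardsU -[RHS]subn0; congr (_ - _)%N.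
apply/eqP; rewrite cards_eq0 setI_eq0; apply/pred0P => c /=.
apply/negP => /andP[/imsetP[a Na ->] /imsetP[k]]; rewrite inE => /andP[Nk Hk].
move/setP/(_ k); rewrite !inE connect0 => ak; move/negP: Nk; apply.
have step u v : u \in N -> dg_adj D u v -> v \in N /\ true.
  move=> Nu; have Hu := subsetP sND _ Nu.
  by case/orP => /eqP->; rewrite ?nN ?oN.
by have [] := connect_closed (e' := fun _ _ => true) step Na ak.
Qed.

Lemma stableD D N : good D -> stable D N -> stable D (dg_half D :\: N).
Proof.
move=> gD [sN nN oN]; split; first exact: subsetDl.
  by move=> h Hh; rewrite !inE nN // Hh (good_next gD Hh).
by move=> h Hh; rewrite !inE oN // Hh (good_opp gD Hh).
Qed.

Section Restrict.
Variables (D : diagram T) (N : {set T}) (gD : good D) (sN : stable D N).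
Local Notation M := (dg_match D).
Local Notation MN := [set e in M | e \subset N].

Lemma stable_half : {subset N <= dg_half D}.
Proof. by case: sN => /subsetP. Qed.

Lemma match_restrict a : a \in N ->
  ([set a; dg_opp D a] \in MN) = ([set a; dg_opp D a] \in M).
Proof.
case: sN => _ _ oN Na; rewrite inE subUset !sub1set oN ?stable_half // Na.
by rewrite !andbT.
Qed.

Lemma cover_restrict a : a \in N -> (a \in cover MN) = (a \in cover M).
Proof.
move=> Na; have sMN : MN \subset M by apply/subsetP=> e; rewrite inE => /andP[].
apply/(mem_cover_match gD _ sMN)/(mem_cover_match gD _ (subxx _));
by rewrite match_restrict.
Qed.

Lemma good_restrict : good (restrict D N).
Proof.
have sH := stable_half; case: (sN) => _ nN oN.
split=> /=.
- by move=> h Nh; rewrite nN ?sH.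
- by move=> h Nh; rewrite oN ?sH.
- by move=> h /sH /(good_oppK gD).
- by move=> h /sH /(good_opp_neq gD).
- move=> e; rewrite inE => /andP[/(good_match gD) [a _ ->]].
  by rewrite subUset !sub1set => /andP[Na _]; exists a.
move=> h Nh; case: (good_vertex gD (sH _ Nh)) => [[h1 h2 h3 h4]|[a ma ha]].
  by left; split; rewrite //= cover_restrict // nN ?sH.
have [Ha Ma a3 a1 a2] := ma.
have Na : a \in N.
  move: ha Nh; rewrite !inE => /or3P[] /eqP->; rewrite ?nN //.
  exact: good_next.
have Nn := good_next gD; right; exists a => //.
by split; rewrite //= cover_restrict ?nN ?Nn ?Nn.
Qed.

(** Smoothing is local: a matching edge with a half in [N] lies in [N], so smoothing everything and
    then restricting agrees with smoothing the restricted diagram. *)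
Lemma components_restrict_smoothing (b b' : {set T} -> bool) :
  {in MN, b =1 b'} ->
  components (restrict (smoothing D M b) (N :\: cover M)) =
  components (smoothing (restrict D N) MN b').
Proof.
have gN := good_restrict; have sH := stable_half; case: (sN) => _ nN oN bb'.
have Nn h : h \in N -> dg_next D h \in N by move=> Nh; rewrite nN ?sH.
have sMN : MN \subset dg_match (restrict D N) by [].
have gS := good_smoothing gN b' sMN.
apply/esym/(components_eq gS) => //= [|h].
  apply/setP => h; rewrite !inE.
  by case: (boolP (h \in N)) => [/cover_restrict->|]; rewrite ?andbF.
rewrite inE => /andP[_ Nh]; rewrite /smooth_next /= !cover_restrict ?Nn ?Nn //.
have edge a : a \in N -> a \in cover M ->
    b [set a; dg_opp D a] = b' [set a; dg_opp D a].
  move=> Na /(mem_cover_match gD _ (subxx _)) [_ aM].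
  by apply: bb'; rewrite match_restrict.
case: ifP => c2; first by rewrite edge ?Nn ?Nn.
by case: ifP => c1 //; rewrite edge ?Nn.
Qed.

End Restrict.

(** Here [x] is the set of 1-smoothed edges among those still present, so the sum makes sense for
    partly smoothed diagrams and can be tested against each rule. *)
Definition state_sum D : K :=
  \sum_(x in powerset (dg_match D))
     (\prod_(e in dg_match D) if e \in x then B else A) *
     C ^+ #|components (smoothing D (dg_match D) (mem x))|.

Lemma state_sum_unmatched D : good D -> dg_match D = set0 ->
  state_sum D = C ^+ #|components D|.
Proof.
move=> gD M0; rewrite /state_sum M0 powerset0 big_set1 big_set0 mul1r.
have c0 : cover set0 = set0 :> {set T} by rewrite /cover big_set0.
congr (_ ^+ #|pred_of_set _|); apply/esym/components_eq => //=.
  by rewrite c0 setD0.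
by move=> h _; rewrite /smooth_next c0 !inE.
Qed.

(** After [e] is smoothed, the free halves at its ends are bivalent and the later smoothings ignore
    them, while the ends of the other edges still look as in [D]. The result is that of smoothing
    all edges at once. *)
Lemma components_smoothing_edge D e (x : {set {set T}}) (b : bool) : good D ->
  e \in dg_match D -> x \subset dg_match D :\ e ->
  components (smoothing (smoothing D [set e] (fun=> b)) (dg_match D :\ e) (mem x))
  = components (smoothing D (dg_match D) (mem (if b then e |: x else x))).
Proof.
move=> gD eM; rewrite subsetD1 => /andP[xM ex].
set M := dg_match D in eM xM *; set y := if b then _ else _.
have se : [set e] \subset dg_match D by rewrite sub1set.
have g1 := good_smoothing gD (fun=> b) se.
have sMe : M :\ e \subset dg_match (smoothing D [set e] (fun=> b)) by [].
have g2 := good_smoothing g1 (mem x) sMe.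
have cD a : (a \in cover (M :\ e)) = (a \in cover M) && (a \notin cover [set e]).
  by rewrite (cover_matchD gD).
have yx f : f != e -> (f \in y) = (f \in x).
  by move=> fe; rewrite /y; case: b {g1 sMe g2 y} => //; rewrite !inE (negPf fe).
have ye : (e \in y) = b.
  by rewrite /y; case: b {g1 sMe g2 y yx}; rewrite ?setU11 ?(negPf ex).
have EH : (dg_half D :\: cover [set e]) :\: cover (M :\ e) = dg_half D :\: cover M.
  apply/setP => a; rewrite !inE cD negb_and negbK.
  case: (boolP (a \in cover M)) => //= aM.
    by case: (a \in cover [set e]); rewrite ?andbF.
  by rewrite (cover_sub gD se aM).
apply: components_eq g2 _ _ _ => //= h; rewrite EH => hM.
(* The middle case is void: every matched half lies in the cover of [M], so no vertex is left
   unsmoothed. *)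
case: (smooth_half gD hM) => [bh|[a [[_ -> //]]]|[a [ma aM ha]]].
  rewrite (smooth_next_bivalent gD _ (subxx _) bh).
  rewrite (smooth_next_bivalent g1 _ sMe) /=; last exact: smoothing_bivalent.
  exact: smooth_next_bivalent.
have [Ha _ _ _ _] := ma; have mb := matched_opp gD ma.
have [n1 n2] := (smooth_next1 (S := M) (mem y) ma aM,
                 smooth_next2 gD (mem y) (subxx _) ma aM).
have [ae|ae] := boolP (a \in cover [set e]).
  have Ee : [set a; dg_opp D a] = e.
    by have /(mem_cover_match gD _ se) [_] := ae; rewrite inE => /eqP.
  rewrite (smooth_next_bivalent g1 _ sMe) /=; last first.
    exact: (smoothing_site gD _ se ma ae ha).
  have [m1 m2] := (smooth_next1 (fun=> b) ma ae, smooth_next2 gD (fun=> b) se ma ae).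
  by case: ha => ->; rewrite ?m1 ?m2 ?n1 ?n2 /= Ee ye.
have be : dg_opp D a \notin cover [set e] by rewrite (cover_opp gD).
have [a1 a2 _] := smoothing_next_matched gD (fun=> b) se ma ae.
have [b1 b2 _] := smoothing_next_matched gD (fun=> b) se mb be.
have m1 := smoothing_matched gD (fun=> b) se ma ae.
have aMe : a \in cover (M :\ e) by rewrite cD aM.
have Ee : [set a; dg_opp D a] != e.
  apply: contra ae => /eqP Ee.
  by apply/(mem_cover_match gD _ se); rewrite Ee set11.
have [k1 k2] := (smooth_next1 (mem x) m1 aMe, smooth_next2 g1 (mem x) sMe m1 aMe).
rewrite /= a1 ?a2 b1 b2 in k1 k2.
by case: ha => ->; rewrite ?k1 ?k2 ?n1 ?n2 /= yx.
Qed.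

Lemma state_sum_edge D e : good D -> e \in dg_match D ->
  state_sum D = A * state_sum (smoothing D [set e] (fun=> false)) +
                B * state_sum (smoothing D [set e] (fun=> true)).
Proof.
move=> gD eM; rewrite /state_sum (sum_powersetD1 _ eM) big_split /= !mulr_sumr.
congr (_ + _); apply: eq_bigr => x; rewrite inE => xM;
  rewrite (big_setD1 e) //= components_smoothing_edge // mulrA.
  move: xM; rewrite subsetD1 => /andP[_ /negPf->]; congr (_ * _ * _).
rewrite setU11; congr (_ * _ * _); apply: eq_bigr => f; rewrite !inE.
by move=> /andP[/negPf-> _].
Qed.

(** Each set of edges splits uniquely into a part inside [N] and a part inside the complement; the
    weights multiply and the numbers of circles add. *)
Lemma state_sum_union D N : good D -> stable D N ->
  state_sum D = state_sum (restrict D N) * state_sum (restrict D (dg_half D :\: N)).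
Proof.
move=> gD sN; have sN' := stableD gD sN; set N' := _ :\: N in sN' *.
rewrite /state_sum /=; set M := dg_match D.
set M1 := [set e in M | e \subset N]; set M2 := [set e in M | e \subset N'].
have dM : [disjoint M1 & M2].
  apply/pred0P => e /=; apply/negP; rewrite !inE => /andP[/andP[eM eN] /andP[_ eN']].
  have [a _ Ee] := good_match gD eM; have ae : a \in e by rewrite Ee set21.
  by have := subsetP eN' _ ae; rewrite inE (subsetP eN _ ae).
have MU : M = M1 :|: M2.
  apply/setP => e; rewrite !inE -andb_orr; case: (boolP (e \in M)) => //= eM.
  have [a Ha ->] := good_match gD eM; rewrite !subUset !sub1set !inE Ha.
  have [_ _ oN] := sN; rewrite oN // (good_opp gD Ha).
  by case: (a \in N).
rewrite [in powerset M]MU sum_powersetU // mulr_suml.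
apply: eq_bigr => x; rewrite inE => xM; rewrite mulr_sumr.
apply: eq_bigr => y; rewrite inE => yM.
have Ex : {in M1, mem (x :|: y) =1 mem x}.
  move=> e eM /=; rewrite in_setU; case: (boolP (e \in y)); rewrite ?orbF //.
  by move/(subsetP yM); rewrite (disjointFr dM eM).
have Ey : {in M2, mem (x :|: y) =1 mem y}.
  move=> e eM /=; rewrite in_setU; case: (boolP (e \in x)) => //.
  by move/(subsetP xM); rewrite (disjointFl dM eM).
have sS : stable (smoothing D M (mem (x :|: y))) (N :\: cover M).
  have gS := good_smoothing gD (mem (x :|: y)) (subxx M).
  have [sH nN oN] := sN; split=> /=.
  - exact: setSD.
  - move=> h hh; have := good_next gS hh; rewrite /= !inE => /andP[-> _] /=.
    move: hh; rewrite !inE => /andP[-> Hh] /=.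
    have Hn := good_next gD; have Ho := good_opp gD.
    rewrite /smooth_next; do 2?[case: ifP => _]; repeat case: ifP => _;
    by rewrite ?(nN, oN) ?(Hn, Ho) ?(Hn, Ho) ?(Hn, Ho) ?(Hn, Ho).
  - move=> h; rewrite !inE => /andP[hM Hh].
    by rewrite oN // (cover_opp gD).
rewrite [X in _ * C ^+ X = _](card_components_restrict sS) /=.
have -> : (dg_half D :\: cover M) :\: (N :\: cover M) = N' :\: cover M.
  by apply/setP => h; rewrite !inE; case: (h \in cover M); rewrite //= andbF.
rewrite (components_restrict_smoothing gD sN Ex).
rewrite (components_restrict_smoothing gD sN' Ey) exprD.
rewrite (eq_bigl [in [predU M1 & M2]]) => [|e]; last by rewrite MU !inE.
rewrite bigU //=.
rewrite mulrACA; congr (_ * _ * (_ * _)); apply: eq_bigr => e.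
  by move/Ex => /= ->.
by move/Ey => /= ->.
Qed.

Lemma bracket_state_sum D z : good D -> bracket A B C D z -> z = state_sum D.
Proof.
move=> gD b; elim: b gD => {D z}.
- move=> D e x y eM _ IHx _ IHy gD.
  have se : [set e] \subset dg_match D by rewrite sub1set.
  by rewrite (state_sum_edge gD eM) IHx ?IHy //; exact: good_smoothing.
- move=> D [cD hD] gD; rewrite state_sum_unmatched ?cD //.
  (* A circle has no matching edge: at a matched half [next] has order three, whereas on a circle it
     is a fixed-point-free involution. *)
  apply/eqP/set0Pn => -[e eM]; have [a Ha Ee] := good_match gD eM.
  have [_ _ a3 _ _] : matched D a.
    apply: matched_cover => //; apply/(mem_cover_match gD _ (subxx _)).
    by rewrite -Ee.
  by have [/eqP n1 n2] := hD _ Ha; case: n1; rewrite -{2}a3 n2.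
- move=> D N x y sN nN oN _ IHx _ IHy gD.
  have st : stable D N by [].
  rewrite (state_sum_union gD st) IHx ?IHy //; last exact: good_restrict.
  by apply: good_restrict => //; exact: stableD.
Qed.

(** Without matching edges every point is bivalent, so both maps are involutions on [dg_half] and
    adjacency is symmetric. *)
Lemma connect_unmatched_sym D h k : good D -> dg_match D = set0 ->
  h \in dg_half D -> connect (dg_adj D) h k -> connect (dg_adj D) k h.
Proof.
move=> gD M0 Hh hk.
suff step u v : u \in dg_half D -> dg_adj D u v ->
    v \in dg_half D /\ [rel v w | dg_adj D w v] u v.
  by have [_] := connect_closed step Hh hk; rewrite connect_rev.
move=> Hu /orP[] /eqP->.
  split; [exact: good_next|apply/orP; left].
  have [[_ -> //]|[a [_ ]]] := good_vertex gD Hu.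
  by rewrite M0 /cover big_set0 inE.
by split; [exact: good_opp|rewrite /= /dg_adj (good_oppK gD Hu) eqxx orbT].
Qed.

Lemma component_stable D h : good D -> dg_match D = set0 -> h \in dg_half D ->
  stable D [set k | connect (dg_adj D) h k].
Proof.
move=> gD M0 Hh.
have adj u v : u \in dg_half D -> dg_adj D u v ->
    connect (dg_adj D) h v = connect (dg_adj D) h u.
  move=> Hu /connect1 uv; have vu := connect_unmatched_sym gD M0 Hu uv.
  by apply/idP/idP => hu; exact: connect_trans hu _.
split.
- apply/subsetP => k; rewrite inE => hk.
  have step u v : u \in dg_half D -> dg_adj D u v -> v \in dg_half D /\ dg_adj D u v.
    move=> Hu uv; split=> //.
    by case/orP: uv => /eqP->; [exact: good_next | exact: good_opp].
  by have [] := connect_closed step Hh hk.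
- by move=> k Hk; rewrite !inE; apply: adj => //; rewrite /dg_adj eqxx.
- by move=> k Hk; rewrite !inE; apply: adj => //; rewrite /dg_adj eqxx orbT.
Qed.

(** While a matching edge remains, smoothing it removes half-edges; afterwards one component is
    split off, until a single component is left, which is a circle. *)
Lemma bracket_exists D : good D -> dg_half D != set0 ->
  bracket A B C D (state_sum D).
Proof.
have [n] := ubnP #|dg_half D|; elim: n D => // n IHn D; rewrite ltnS => leDn gD.
move=> /set0Pn[h Hh]; have [M0|/set0Pn[e eM]] := eqVneq (dg_match D) set0.
  set N := [set k | connect (dg_adj D) h k].
  have sN : stable D N by exact: component_stable.
  have [sH nN oN] := sN; have hN : h \in N by rewrite inE connect0.
  have [D0|D0] := eqVneq (dg_half D :\: N) set0.
    have EN : N = dg_half D by apply/eqP; rewrite eqEsubset sH -setD_eq0 D0 /=.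
    have c1 : components D = [set N].
      apply/setP => c; rewrite inE; apply/imsetP/eqP => [[k Hk ->]|->]; last by exists h.
      have sK := component_stable gD M0 Hk.
      apply/setP=> u; rewrite !inE.
      have hk : connect (dg_adj D) h k by move: Hk; rewrite -EN inE.
      apply/idP/idP; first exact: connect_trans.
      exact/connect_trans/connect_unmatched_sym.
    rewrite state_sum_unmatched // c1 cards1 expr1; apply: bracket_circle.
    split=> [|k Hk]; first by rewrite c1 cards1.
    have [[]//|[a [_ ]]] := good_vertex gD Hk.
    by rewrite M0 /cover big_set0 inE.
  have sN' := stableD gD sN.
  rewrite (state_sum_union gD sN); apply: (bracket_union sH nN oN); apply: IHn => //=.
  - apply: leq_trans leDn; apply: proper_card; rewrite properEneq sH andbT.
    by apply: contra D0 => /eqP->; rewrite setDv.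
  - exact: good_restrict.
  - by apply/set0Pn; exists h.
  - apply: leq_trans leDn; apply: proper_card; rewrite properEneq subsetDl andbT.
    by apply/eqP => /setP/(_ h); rewrite inE hN Hh.
  - exact: good_restrict.
have se : [set e] \subset dg_match D by rewrite sub1set.
have [a Ha Ee] := good_match gD eM.
have ae : a \in cover [set e] by rewrite /cover big_set1 Ee set21.
have ma : matched D a.
  by apply: (matched_cover gD); apply/(mem_cover_match gD _ (subxx _)); rewrite -Ee.
rewrite (state_sum_edge gD eM); apply: (bracket_edge eM); apply: IHn => /=;
  try exact: good_smoothing.
all: try (apply: leq_trans leDn; apply: proper_card; apply/properP; split;
  [exact: subsetDl | by exists a; rewrite // inE ae]).
(* The half [next a] is not on the deleted edge, so the smoothed diagram is nonempty. *)
all: apply/set0Pn; exists (dg_next D a); have [_ _ _ a1 _] := ma.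
all: by rewrite inE (cover_sub gD se a1) good_next.
Qed.

End StateSum.

(** * The Euler characteristic *)

Section GoodDiagram.
Variables (P : pm_graph) (P3 : trivalent P).
Local Notation next := (rg_next P).
Local Notation opp := (rg_opp P).
Local Notation M := (pm_match P).

Lemma porbit_next3 (h : P) :
  [/\ next (next (next h)) = h, uniq [:: h; next h; next (next h)]
    & porbit next h =i [:: h; next h; next (next h)]].
Proof.
have c3 : #|porbit next h| = 3 by apply: P3; apply/imsetP; exists h.
have := iter_porbit next h; have := uniq_traject_porbit next h.
by have := porbit_traject next h; rewrite c3.
Qed.

Lemma porbit_opp (h : P) : porbit opp h = [set h; opp h].
Proof.
apply/setP => k; rewrite !inE; apply/porbitP/orP => [[i ->]|[]/eqP->].
- elim: i => [|i IHi]; first by left; rewrite perm1.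
  rewrite expgSr permM; case: IHi => /eqP->; [by right|left].
  by rewrite rg_opp_inv.
- by exists 0; rewrite perm1.
- by exists 1.
Qed.

Lemma match_porbit e : e \in M -> exists a : P, e = [set a; opp a].
Proof.
have [/subsetP sM _ _] := pm_perfect P.
by move=> /sM /imsetP[a _ ->]; exists a; rewrite porbit_opp.
Qed.

Lemma good_diagram_of : good (diagram_of P).
Proof.
split=> //=.
- by move=> h _; rewrite rg_opp_inv.
- by move=> h _; rewrite rg_opp_free.
- by move=> e /match_porbit[a ->]; exists a.
move=> h _; right; have [_ le1 eq1] := pm_perfect P.
set v := porbit next h; have Vv : v \in rg_vertices P by apply/imsetP; exists h.
have /eqP/cards1P[e ve] := eq1 v Vv.
have : e \in [set f in M | ~~ [disjoint f & v]] by rewrite ve set11.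
rewrite inE => /andP[eM nd].
have [a] := pred0Pn nd => /= /andP[ae av].
have Ev : porbit next a = v by apply/eqP; rewrite eq_porbit_mem.
have [a3 ua va] := porbit_next3 a.
(* Exactly one matching edge meets the vertex, and it does so in at most one half since it is not a
   loop. *)
have cov k : k \in v -> k \in cover M -> k = a.
  move=> kv /bigcupP[f fM kf].
  have /set1P fe : f \in [set e].
    by rewrite -ve inE fM; apply/pred0Pn; exists k; rewrite /= kf.
  rewrite fe in kf.
  have /card_le1P := le1 e v eM Vv.
  by move=> /(_ a); rewrite inE ae av => /(_ isT k); rewrite !inE kf kv => /esym/eqP.
have ncov k : k \in v -> k != a -> k \notin cover M.
  by move=> kv; apply: contra => /(cov _ kv) /eqP.
move: ua; rewrite /= !inE negb_or -andbA => /and4P[n1 n2 _ _].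
exists a; last by rewrite -va Ev porbit_id.
split=> //=.
- by apply/bigcupP; exists e.
- by rewrite ncov 1?eq_sym // -Ev va !inE eqxx orbT.
- by rewrite ncov 1?eq_sym // -Ev va !inE eqxx !orbT.
Qed.

End GoodDiagram.

(** * Graded ranks as counts of homogeneous basis elements *)

Section Rank.
Variables (R : comNzRingType) (dim : lmodType R -> int) (dim_rank : extends_rank dim).

Lemma lmod_iso_graded_piece (X : finType) (D : eqType) (deg : X -> D) (d : D) :
  lmod_iso (sub_mod (graded_piece R deg d)) 'rV[R]_#|[pred x | deg x == d]|.
Proof.
set A := [pred x | _].
pose f (u : sub_mod (graded_piece R deg d)) : 'rV[R]_#|A| :=
  \row_j (sub_val u) (enum_val j).
have f_lin : linear f by move=> a u v; apply/rowP => j; rewrite !mxE /= !ffunE.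
pose f' := GRing.isLinear.Build R _ _ _ f f_lin.
pose fL : {linear sub_mod (graded_piece R deg d) -> 'rV[R]_#|A|} := HB.pack f f'.
pose w (r : 'rV[R]_#|A|) : freemod R X := [ffun x => \sum_j r 0 j *+ (x == enum_val j)].
have hw r : homogeneous deg d (w r).
  move=> x; rewrite ffunE => wx; apply/eqP; apply: contraR wx => nx.
  apply/eqP; rewrite big1 // => j _.
  case: eqP => // xj; have := enum_valP j; rewrite -xj inE.
  by rewrite (negPf nx).
have wP r : w r \in sm_pred (graded_piece R deg d) by apply/asboolP; exact: hw.
exists fL; exists (fun r => SubMod (wP r)).
  move=> u; apply: val_inj; apply/ffunP => x; rewrite /= ffunE.
  have /asboolP hu := sub_valP u.
  have [ux|ux] := eqVneq (sub_val u x) 0.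
    rewrite ux big1 // => j _; rewrite mxE; case: eqP => [<-|//].
    by rewrite ux mul0rn.
  have Ax : x \in A by rewrite inE (hu x ux).
  rewrite (bigD1 (enum_rank_in Ax x)) //= mxE enum_rankK_in // eqxx mulr1n.
  rewrite big1 ?addr0 // => j nj; case: eqP => // xj.
  by case/eqP: nj; apply: enum_val_inj; rewrite enum_rankK_in.
move=> r; apply/rowP => j; rewrite /= mxE /= ffunE (bigD1 j) //= eqxx mulr1n.
rewrite big1 ?addr0 // => k nk; case: eqP => // /enum_val_inj jk.
by rewrite jk eqxx in nk.
Qed.

Lemma dim_graded_piece (X : finType) (D : eqType) (deg : X -> D) (d : D) :
  dim (sub_mod (graded_piece R deg d)) = #|[pred x | deg x == d]|%:Z.
Proof.
have [iso rk] := dim_rank; rewrite -rk; apply: iso; exact: lmod_iso_graded_piece.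
Qed.

Variable G : zmodType.

(** The predicate [A] serves to select one homological degree in the basis of the whole complex. *)
Lemma qdim_count (X : finType) (A : pred X) (deg : X -> G) (W : G -> lmodType R) :
  (forall g, dim (W g) = #|[pred x | A x && (deg x == g)]|%:Z) ->
  qdim dim W = \sum_(x | A x) gmon (deg x).
Proof.
move=> dW; rewrite /qdim.
(* Only the finitely many degrees attained by [deg] contribute to the sum over all of [G]. *)
rewrite (fsbigE (undup (codom deg))) ?undup_uniq //; last first.
  move=> g _ ng; rewrite dW eq_card0 ?mulr0z // => x; rewrite !inE.
  apply/negP => /andP[_ /eqP xg]; case/negP: ng.
  by rewrite mem_undup -xg codom_f.
under eq_bigl => g do rewrite classical_sets.in_setT.
under eq_bigr => g _ do rewrite dW -pmulrn -sumr_const big_mkcondr.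
rewrite exchange_big; apply: eq_bigr => x _ /=.
rewrite (bigD1_seq (deg x)) ?undup_uniq ?mem_undup ?codom_f //= eqxx.
by rewrite big1 ?addr0 // => g; rewrite eq_sym => /negPf->.
Qed.

Lemma gmonD (x y : G) : gmon (x + y) = gmon x * gmon y.
Proof. by rewrite [RHS]gmulUU mulr1. Qed.

Lemma gmon_sum (I : finType) (f : I -> G) : gmon (\sum_i f i) = \prod_i gmon (f i).
Proof. exact: (big_morph _ gmonD). Qed.

End Rank.

(** Both sides are one signed sum of monomials over the basis of the complex, grouped by homological
    degree on the left and by state on the right. *)
Lemma euler_char_state_sum (R : comNzRingType) (F : MTQFT R) (G : zmodType)
    (deg : mt_basis F -> G) (shift : G) (P : pm_graph) (dim : lmodType R -> int) :
  extends_rank dim ->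
  euler_char deg shift P dim =
  state_sum 1 (- gmon shift) (qdim dim (fun x => sub_mod (graded_piece R deg x)))
    (diagram_of P).
Proof.
move=> rk; pose B := cx_basis F P.
have Eq (i : nat) : qdim dim (cx_piece deg shift P i) =
    \sum_(b : B | hdeg b == i) gmon (gdeg deg shift b).
  apply: qdim_count => g; rewrite dim_graded_piece //.
have -> : qdim dim (fun x => sub_mod (graded_piece R deg x)) = \sum_x gmon (deg x).
  by apply: qdim_count => g; rewrite dim_graded_piece.
rewrite /euler_char.
have hM (b : B) : (hdeg b < #|pm_match P|.+1)%N.
  by rewrite ltnS; exact: subset_leq_card (valP (tag b)).
transitivity (\sum_(b : B) (- 1) ^+ hdeg b * gmon (gdeg deg shift b)).
  (* By [hM] the coercion [inord] alters no homological degree. *)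
  rewrite [RHS](partition_big (fun b => inord (hdeg b) : 'I_#|pm_match P|.+1) xpredT) //.
  apply: eq_bigr => i _; rewrite Eq mulr_sumr.
  have E (b : B) : (inord (hdeg b) == i) = (hdeg b == i).
    by rewrite -val_eqE /= inordK ?hM.
  rewrite [RHS](eq_bigl (fun b => hdeg b == i)) => [|b]; last exact: E.
  by apply: eq_bigr => b /eqP->.
rewrite -(sig_big_dep xpredT (fun _ => xpredT)
  (fun (a : state P) (f : {ffun circle a -> mt_basis F}) =>
     (- 1) ^+ #|val a| * gmon (\sum_c deg (f c) + shift *+ #|val a|))) /=.
rewrite /state_sum /=.
under [RHS]eq_bigl => a do rewrite powersetE.
rewrite [RHS](big_sub [pred a : {set {set P}} | a \subset pm_match P]) /=.
apply: eq_bigr => a _; have aM := valP a.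
rewrite -big_mkcondr (eq_bigl [in val a]) => [|e]; last first.
  by rewrite andb_idl // => /(subsetP aM).
have <- : #|circle a| = #|components (state_diagram a)| by rewrite card_sig.
rewrite !prodr_const [(- gmon shift) ^+ _]exprNn -mulrA.
under eq_bigr => f _ do rewrite gmonD gmon_sum [X in _ * X]mulrC.
(* Distributivity: the sum over labellings of the circles is a product, over the circles, of the
   graded dimension of [V]. *)
rewrite -mulr_sumr -mulr_sumr -(bigA_distr_bigA (fun _ x => gmon (deg x))) /=.
rewrite prodr_const; congr (_ * (_ * _)).
elim: #|_| => [|k IHk]; first by rewrite mulr0n.
by rewrite mulrS gmonD IHk exprS.
Qed.

Lemma bracket_euler_char (R : comNzRingType) (F : MTQFT R) (G : zmodType)
    (deg : mt_basis F -> G) (shift : G) (P : pm_graph) (dim : lmodType R -> int)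
    (z : group_ring G) :
  extends_rank dim -> trivalent P ->
  bracket 1 (- gmon shift) (qdim dim (fun x => sub_mod (graded_piece R deg x)))
    (diagram_of P) z <-> z = euler_char deg shift P dim.
Proof.
move=> rk P3; rewrite euler_char_state_sum //.
split=> [|->]; first exact/bracket_state_sum/good_diagram_of.
apply: bracket_exists; first exact: good_diagram_of.
by rewrite -card_gt0 /= cardsT rg_nonempty.
Qed.

(** * Invariance of the homology *)

Section SubquotientIso.
Variables (R : comNzRingType) (U U' : lmodType R) (f : {linear U -> U'}).
Variables (W : submodule U) (W' : submodule U').
Hypotheses (f_bij : bijective f) (fW : forall u, sm_mem W u <-> sm_mem W' (f u)).

Lemma sub_mod_iso : exists2 h : {linear sub_mod W -> sub_mod W'},
  bijective h & forall u, val (h u) = f (val u).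
Proof.
have [f' fK f'K] := f_bij.
have hP (u : sub_mod W) : f (val u) \in sm_pred W'.
  by apply/asboolP; have /asboolP/fW := valP u.
pose h u : sub_mod W' := SubMod (hP u).
have h_lin : linear h by move=> a u v; apply: val_inj; rewrite /= !linearP.
pose hL : {linear sub_mod W -> sub_mod W'} :=
  HB.pack h (GRing.isLinear.Build R _ _ _ h h_lin).
exists hL => //.
have hP' (u : sub_mod W') : f' (val u) \in sm_pred W.
  by apply/asboolP/fW; rewrite f'K; have /asboolP := valP u.
exists (fun u => SubMod (hP' u)) => u; apply: val_inj => /=.
  exact: fK.
exact: f'K.
Qed.

Lemma quot_mod_iso : lmod_iso (quot_mod W) (quot_mod W').
Proof.
have [f' fK f'K] := f_bij.
pose q (u : U) : quot_mod W := \pi_(Quotient.quot (sm_pred W : zmodClosed U))%qT u.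
pose q' (u : U') : quot_mod W' := \pi_(Quotient.quot (sm_pred W' : zmodClosed U'))%qT u.
have qP u v : reflect (sm_mem W (u - v)) (q u == q v) by exact: quot_eqP.
have qP' u v : reflect (sm_mem W' (u - v)) (q' u == q' v) by exact: quot_eqP.
have qK x : q (repr (x : Quotient.quot (sm_pred W : zmodClosed U))) = x by exact: reprK.
have qK' x : q' (repr (x : Quotient.quot (sm_pred W' : zmodClosed U'))) = x by exact: reprK.
pose h (x : quot_mod W) : quot_mod W' :=
  q' (f (repr (x : Quotient.quot (sm_pred W : zmodClosed U)))).
have hq u : h (q u) = q' (f u).
  by apply/eqP/qP'; rewrite -linearB; apply/fW/qP; rewrite qK.
have qL a u v : q (a *: u + v) = a *: q u + q v.
  by rewrite /q quot_piD -quot_scaleE.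
have qL' a u v : q' (a *: u + v) = a *: q' u + q' v.
  by rewrite /q' quot_piD -quot_scaleE.
have h_lin : linear h.
  by move=> a x y; rewrite -(qK x) -(qK y) -qL !hq linearP qL'.
pose hL : {linear quot_mod W -> quot_mod W'} :=
  HB.pack h (GRing.isLinear.Build R _ _ _ h h_lin).
exists hL.
exists (fun x => q (f' (repr (x : Quotient.quot (sm_pred W' : zmodClosed U'))))).
  move=> x; rewrite -{2}(qK x) /=; apply/eqP/qP/fW.
  by rewrite linearB f'K; apply/qP'; rewrite qK'.
by move=> x; rewrite /= hq f'K qK'.
Qed.
End SubquotientIso.

Section Relabelling.
Variables (R : comNzRingType) (F : MTQFT R) (G : zmodType).
Variables (deg : mt_basis F -> G) (shift : G).
Variables (P P' : pm_graph) (ord : seq {set P}) (ord' : seq {set P'}).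
Variable T : {linear cx F P -> cx F P'}.
Hypothesis T_bij : bijective T.
Hypothesis T_diff : forall v, diff F ord' (T v) = T (diff F ord v).
Hypothesis T_homogeneous : forall (D : eqType) (d : D) (k : nat -> G -> D) v,
  homogeneous (fun b => k (hdeg b) (gdeg deg shift b)) d v <->
  homogeneous (fun b => k (hdeg b) (gdeg deg shift b)) d (T v).

(** The free function [k] in [T_homogeneous] lets one hypothesis serve the bidegree of cycles and
    the shifted bidegree of the chains that bound. *)
Lemma homology_iso i g :
  lmod_iso (moebius_homology deg shift ord i g) (moebius_homology deg shift ord' i g).
Proof.
have [T' TK T'K] := T_bij.
have cyc u : sm_mem (cycles deg shift ord i g) u <->
             sm_mem (cycles deg shift ord' i g) (T u).
  rewrite /= /cycle_mem T_diff; split=> -[/(T_homogeneous (i, g) pair) hu du].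
    by rewrite du linear0.
  split=> //; apply: (bij_inj T_bij); rewrite du linear0 //.
have [h h_bij hE] := sub_mod_iso T_bij cyc.
apply: (quot_mod_iso h_bij) => z; rewrite /= /boundary_mem.
(* Chains of homological degree i - 1 are described by successor equal to i, so that there are none
   for i = 0. *)
pose k j x : nat * G := (j.+1, x).
split=> -[w hw dw].
  exists (T w); first exact/(T_homogeneous (i, g) k).
  by rewrite T_diff dw hE.
exists (T' w); first by apply/(T_homogeneous (i, g) k); rewrite T'K.
by apply: (bij_inj T_bij); rewrite -T_diff T'K dw hE.
Qed.
End Relabelling.

(** * Symmetry of the edge maps *)

Section EdgeMaps.
Variables (R : comNzRingType) (F : MTQFT R).
Local Notation X := (mt_basis F).

Lemma reindex_swap (v : freemod R (X * X)) x y :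
  Defs.reindex (fun p : X * X => (p.2, p.1)) v (x, y) = v (y, x).
Proof. by rewrite ffunE. Qed.

Lemma mt_muC (v : freemod R (X * X)) :
  mt_mu F (Defs.reindex (fun p : X * X => (p.2, p.1)) v) = mt_mu F v.
Proof. by rewrite /mt_mu -mt_sym -mt_hom_comp; exact/mt_hom_eq/ceq_muC. Qed.

Lemma mt_mu_delta x y : mt_mu F (fdelta R (x, y)) = mt_mu F (fdelta R (y, x)).
Proof.
rewrite -mt_muC; congr mt_mu; apply/ffunP => -[a b].
by rewrite !ffunE /= !xpair_eqE andbC.
Qed.

(** The structure isomorphism [mt_phi] is injective and carries the exchange of factors to the image
    of the swap, which [CDelta] absorbs. *)
Lemma mt_DeltaC v x y : mt_Delta F v (x, y) = mt_Delta F v (y, x).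
Proof.
suff {1}-> : mt_Delta F v = Defs.reindex (fun p : X * X => (p.2, p.1)) (mt_Delta F v).
  exact: reindex_swap.
have phiD : mt_phi F 1 1 (mt_Delta F v) = mt_hom F CDelta v by exact: mt_psiK.
apply: (can_inj (@mt_phiK _ F 1 1)); rewrite -mt_sym phiD -mt_hom_comp.
exact/esym/mt_hom_eq/ceq_DeltaC.
Qed.

Definition edge_map (s t : seq X) : R :=
  match s, t with
  | [:: x1; x2], [:: y] => mt_mu F (fdelta R (x1, x2)) y
  | [:: x], [:: y1; y2] => mt_Delta F (fdelta R x) (y1, y2)
  | [:: x], [:: y] => mt_m F (fdelta R x) y
  | _, _ => 0
  end.

Lemma perm_eq_pair (T : eqType) (x y : T) s : perm_eq [:: x; y] s ->
  s = [:: x; y] \/ s = [:: y; x].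
Proof.
move=> xs; have := perm_size xs; case: s xs => [|u [|v []]] // xs _.
have := perm_mem xs u; rewrite !inE eqxx => /orP[] /eqP uE.
  by left; move: xs; rewrite uE perm_cons => /perm_small_eq->.
right; move: xs; rewrite uE -[[:: x; y]]/([:: x] ++ [:: y]) perm_catC perm_cons.
by move/perm_small_eq->.
Qed.

(** The affected circles are listed in the order of an enumeration of sets, which a relabelling may
    permute; commutativity and cocommutativity absorb the exchange of two entries. *)
Lemma edge_map_perm s s' t t' : perm_eq s s' -> perm_eq t t' ->
  edge_map s t = edge_map s' t'.
Proof.
move=> ss' tt'; transitivity (edge_map s t').
  case: s {ss'} => [|x [|x' [|]]] //; case: t tt' => [|y [|y' [|y'' t]]] tt' //=;
  have := perm_size tt'; case: t' tt' => [|z [|z' [|z'' t']]] //= tt' _;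
  try by move: tt' => /perm_small_eq => /(_ isT) [->].
  by case: (perm_eq_pair tt') => -[-> ->]; rewrite // mt_DeltaC.
case: t' {tt'} => [|y [|y' [|]]] //; case: s ss' => [|x [|x' [|x'' s]]] ss' //=;
have := perm_size ss'; case: s' ss' => [|z [|z' [|z'' s']]] //= ss' _;
try by move: ss' => /perm_small_eq => /(_ isT) [->].
by case: (perm_eq_pair ss') => -[-> ->]; rewrite // mt_mu_delta.
Qed.

Lemma edge_entry_map (P : pm_graph) (e : {set P}) (a a' : state P)
    (f : {ffun circle a -> X}) (f' : {ffun circle a' -> X}) :
  edge_entry e f f' =
  if [forall c, forall c', (val c == val c') && ~~ affected e c ==> (f c == f' c')]
  then edge_map [seq f c | c <- enum (@affected P e a)]
                [seq f' c | c <- enum (@affected P e a')]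
  else 0.
Proof.
rewrite /edge_entry; case: ifP => // _.
by case: (enum _) => [|c1 [|c2 [|]]] //; case: (enum _) => [|d1 [|d2 [|]]].
Qed.

(** Circles of two states have different types; comparing them by their underlying sets avoids
    transport along an equality of states. *)
Lemma cx_basis_eq (P : pm_graph) (b1 b2 : cx_basis F P) :
  val (tag b1) = val (tag b2) ->
  (forall c1 c2, val c1 = val c2 -> tagged b1 c1 = tagged b2 c2) -> b1 = b2.
Proof.
case: b1 b2 => [a1 f1] [a2 f2] /= /val_inj Ea; case: a2 / Ea f2 => f2 Ef.
by congr existT; apply/ffunP => c; exact: Ef.
Qed.

End EdgeMaps.

(** * Isomorphisms of perfect matching graphs acting on states, circles and bases *)

Lemma connect_homo (T T' : finType) (e : rel T) (e' : rel T') (f : T -> T') x y :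
  (forall x y, e x y -> e' (f x) (f y)) -> connect e x y -> connect e' (f x) (f y).
Proof.
move=> fe /connectP[p]; elim: p x => [|z p IHp] x /=; first by move=> _ ->.
by move=> /andP[/fe xz zp] /(IHp _ zp); exact/connect_trans/connect1.
Qed.

(* The two maps are kept separate, with no bundled inverse, so that exchanging
   them yields the inverse isomorphism. *)
Record pm_iso (P P' : pm_graph) (phi : P -> P') (psi : P' -> P) : Prop := PmIso {
  iso_K : cancel phi psi;
  iso_K' : cancel psi phi;
  iso_next : forall h, phi (rg_next P h) = rg_next P' (phi h);
  iso_opp : forall h, phi (rg_opp P h) = rg_opp P' (phi h);
  iso_match : forall e : {set P}, (phi @: e \in pm_match P') = (e \in pm_match P)
}.

Lemma imsetK (T T' : finType) (f : T -> T') (f' : T' -> T) (A : {set T}) :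
  cancel f f' -> f' @: (f @: A) = A.
Proof. by move=> fK; rewrite -imset_comp (eq_imset _ fK) imset_id. Qed.

Lemma pm_iso_sym (P P' : pm_graph) (phi : P -> P') (psi : P' -> P) :
  pm_iso phi psi -> pm_iso psi phi.
Proof.
case=> K K' En Eo Em; split=> // [h|h|e].
- by rewrite -{1}(K' h) -En K.
- by rewrite -{1}(K' h) -Eo K.
- by rewrite -Em (imsetK _ K').
Qed.

Lemma pm_equiv_iso (P P' : pm_graph) : pm_equiv P P' ->
  exists (phi : P -> P') (psi : P' -> P), pm_iso phi psi.
Proof.
case=> phi [[psi K K'] En Eo Em]; exists phi, psi; split=> // e.
rewrite Em mem_imset //; exact/imset_inj/(can_inj K).
Qed.

Section Iso.
Variables (P P' : pm_graph) (phi : P -> P') (psi : P' -> P).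
Hypothesis iso : pm_iso phi psi.

Local Notation img := (fun A : {set P} => phi @: A).
Local Notation img' := (fun A : {set P'} => psi @: A).

Let phi_inj : injective phi. Proof. exact: can_inj (iso_K iso). Qed.
Let imgK : cancel img img'. Proof. by move=> A; exact: imsetK (iso_K iso). Qed.
Let imgK' : cancel img' img. Proof. by move=> A; exact: imsetK (iso_K' iso). Qed.
Let img_inj : injective img. Proof. exact: can_inj imgK. Qed.
Let mem_img (A : {set P}) h : (phi h \in phi @: A) = (h \in A).
Proof. exact: mem_imset. Qed.
Let mem_img2 (x : {set {set P}}) (A : {set P}) : (phi @: A \in img @: x) = (A \in x).
Proof. by rewrite mem_imset. Qed.

Lemma iso_matchE : pm_match P' = img @: pm_match P.
Proof. by apply/setP => e; rewrite -(imgK' e) mem_img2 (iso_match iso). Qed.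

Lemma iso_card_match : #|pm_match P'| = #|pm_match P|.
Proof. by rewrite iso_matchE card_imset. Qed.

Lemma iso_cover h : (phi h \in cover (pm_match P')) = (h \in cover (pm_match P)).
Proof.
apply/bigcupP/bigcupP => -[e eM he].
  exists (psi @: e); first by rewrite -(iso_match iso) imgK'.
  by rewrite -mem_img imgK'.
by exists (phi @: e); rewrite ?(iso_match iso) ?mem_img.
Qed.

(** The smoothing rule is expressed through [next], [opp] and the matching alone, all of which the
    isomorphism respects. *)
Lemma iso_smooth_next (x : {set {set P}}) h :
  smooth_next (diagram_of P') (pm_match P') (fun e => e \in img @: x) (phi h) =
  phi (smooth_next (diagram_of P) (pm_match P) (fun e => e \in x) h).
Proof.
rewrite /smooth_next /= -!(iso_next iso) !iso_cover -!(iso_opp iso) -!(iso_next iso).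
have E a b : ([set phi a; phi b] \in img @: x) = ([set a; b] \in x).
  by rewrite -mem_img2 imsetU1 imset_set1.
by rewrite !E; do 2?case: ifP => _ //; case: ifP.
Qed.

Lemma iso_components (x : {set {set P}}) :
  components (smoothing (diagram_of P') (pm_match P') (fun e => e \in img @: x)) =
  img @: components (smoothing (diagram_of P) (pm_match P) (fun e => e \in x)).
Proof.
rewrite /components /=; set e' := dg_adj _; set e := dg_adj _.
have ee h k : e' (phi h) (phi k) = e h k.
  rewrite /e' /e /dg_adj /= iso_smooth_next -(iso_opp iso).
  by rewrite !(inj_eq phi_inj).
have cc h k : connect e' (phi h) (phi k) = connect e h k.
  apply/idP/idP; last by apply: connect_homo => u v; rewrite ee.
  rewrite -{2}(iso_K iso h) -{2}(iso_K iso k).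
  by apply: connect_homo => u v; rewrite -ee !(iso_K' iso).
have HH : [set: P'] :\: cover (pm_match P') = phi @: ([set: P] :\: cover (pm_match P)).
  by apply/setP => h; rewrite -(iso_K' iso h) mem_img !inE iso_cover.
rewrite HH -!imset_comp; apply: eq_imset => h /=.
by apply/setP => k; rewrite -(iso_K' iso k) mem_img !inE cc.
Qed.

Lemma push_state_subproof (a : state P) : img @: val a \subset pm_match P'.
Proof. by rewrite iso_matchE; apply: imsetS; exact: (valP a). Qed.

Definition push_state (a : state P) : state P' := Sub _ (push_state_subproof a).

Lemma push_circle_subproof a (c : circle a) :
  phi @: val c \in components (state_diagram (push_state a)).
Proof. by rewrite /state_diagram /= iso_components mem_img2; exact: (valP c). Qed.

Definition push_circle a (c : circle a) : circle (push_state a) :=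
  exist (fun c => c \in components (state_diagram (push_state a))) _
    (push_circle_subproof c).

Lemma pull_circle_subproof a (c : circle (push_state a)) :
  psi @: val c \in components (state_diagram a).
Proof.
by rewrite -mem_img2 imgK' -iso_components; exact: (valP c).
Qed.

Definition pull_circle a (c : circle (push_state a)) : circle a :=
  exist (fun c => c \in components (state_diagram a)) _ (pull_circle_subproof c).

Lemma push_circleK a : cancel (@push_circle a) (@pull_circle a).
Proof. by move=> c; apply: val_inj; exact: imgK. Qed.

Lemma pull_circleK a : cancel (@pull_circle a) (@push_circle a).
Proof. by move=> c; apply: val_inj; exact: imgK'. Qed.

Lemma pull_circle_bij a : bijective (@pull_circle a).
Proof. exact: Bijective (@pull_circleK a) (@push_circleK a). Qed.

Lemma iso_porbit h : porbit (rg_next P') (phi h) = phi @: porbit (rg_next P) h.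
Proof.
have E i : (rg_next P' ^+ i)%g (phi h) = phi ((rg_next P ^+ i)%g h).
  elim: i => [|i IHi]; first by rewrite !perm1.
  by rewrite !expgSr !permM IHi (iso_next iso).
apply/setP => k; apply/porbitP/imsetP => [[i ->]|[l /porbitP[i ->] ->]].
  by exists ((rg_next P ^+ i)%g h); rewrite ?E ?mem_porbit.
by exists i.
Qed.

Lemma iso_disjoint (A B : {set P}) : [disjoint phi @: A & phi @: B] = [disjoint A & B].
Proof. by rewrite -!setI_eq0 -imsetI ?imset_eq0 // => u v _ _; exact: phi_inj. Qed.

Lemma iso_site (e : {set P}) : site (phi @: e) = phi @: site e.
Proof.
apply/setP => h; rewrite -(iso_K' iso h) mem_img !inE mem_img iso_porbit.
by rewrite iso_disjoint.
Qed.

Lemma iso_affected (e : {set P}) a (c : circle (push_state a)) :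
  affected (phi @: e) c = affected e (@pull_circle a c).
Proof.
by rewrite /affected iso_site -{1}(pull_circleK c) /= iso_disjoint.
Qed.

Section Chain.
Variables (R : comNzRingType) (F : MTQFT R).
Local Notation X := (mt_basis F).

Definition push_basis (b : cx_basis F P) : cx_basis F P' :=
  Tagged (fun a : state P' => {ffun circle a -> X})
    [ffun c : circle (push_state (tag b)) => tagged b (pull_circle c)].

Lemma hdeg_push b : hdeg (push_basis b) = hdeg b.
Proof. by rewrite /hdeg card_imset. Qed.

Lemma gdeg_push (G : zmodType) (deg : X -> G) shift b :
  gdeg deg shift (push_basis b) = gdeg deg shift b.
Proof.
rewrite /gdeg hdeg_push; congr (_ + _).
rewrite [RHS](reindex _ (onW_bij _ (@pull_circle_bij _))) /=.
by apply: eq_bigr => c _; rewrite ffunE.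
Qed.

Lemma edge_entry_push (e : {set P}) (b b1 : cx_basis F P) :
  edge_entry (phi @: e) (tagged (push_basis b)) (tagged (push_basis b1)) =
  edge_entry e (tagged b) (tagged b1).
Proof.
rewrite !edge_entry_map.
(* The two lists of labels agree only up to permutation, which is all that [edge_map_perm] asks. *)
have enumE a (f : {ffun circle a -> X}) :
    perm_eq [seq [ffun c => f (pull_circle c)] c
              | c <- enum (@affected P' (phi @: e) (push_state a))]
            [seq f c | c <- enum (@affected P e a)].
  rewrite (eq_map (ffunE _)) (map_comp f (@pull_circle a)); apply: perm_map.
  have inj := bij_inj (@pull_circle_bij a).
  apply: uniq_perm; rewrite ?map_inj_uniq ?enum_uniq // => c.
  rewrite -(push_circleK c) mem_map // !mem_enum.
  exact: iso_affected.
rewrite (edge_map_perm (enumE _ (tagged b)) (enumE _ (tagged b1))).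
congr (if _ then _ else _).
have E1 (c : circle (push_state (tag b))) (c' : circle (push_state (tag b1))) :
    (val c == val c') = (val (pull_circle c) == val (pull_circle c')).
  by rewrite /= (inj_eq (can_inj imgK')).
apply/forallP/forallP => H c; apply/forallP => c'.
  have /forallP/(_ (push_circle c')) := H (push_circle c).
  by rewrite !ffunE E1 iso_affected !push_circleK.
have /forallP/(_ (pull_circle c')) := H (pull_circle c).
by rewrite !ffunE E1 iso_affected.
Qed.

End Chain.
End Iso.

Lemma push_basisK (P P' : pm_graph) (phi : P -> P') (psi : P' -> P)
    (iso : pm_iso phi psi) (iso' : pm_iso psi phi) (R : comNzRingType) (F : MTQFT R) :
  cancel (push_basis iso (F := F)) (push_basis iso' (F := F)).
Proof.
have K := iso_K iso; move=> b; apply: cx_basis_eq => [|c1 c2 Ec] /=.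
  rewrite -imset_comp -[RHS]imset_id; apply: eq_imset => e /=.
  exact: imsetK.
rewrite !ffunE; congr (tagged b _); apply: val_inj.
by rewrite /= (imsetK _ K).
Qed.

(** * Signs produced by a change of edge order *)

Section ReorderSign.
Variables (R : comNzRingType) (I : finType) (r1 r2 : rel I).

(** For strict total orders [r1] and [r2], a pair on which they disagree contributes through exactly
    one of its two orderings, so this is the sign of the permutation relating them on [a]. *)
Definition inversion_sign (a : {set I}) : R :=
  \prod_(x in a) \prod_(y in a) (if r1 x y && r2 y x then -1 else 1).

Lemma inversion_sign_sqr a : inversion_sign a * inversion_sign a = 1.
Proof.
rewrite -big_split big1 // => x _; rewrite -big_split big1 // => y _ /=.
by case: ifP => _; rewrite ?mulrNN mulr1.
Qed.

Lemma sign_card (a : {set I}) (r : pred I) :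
  (-1) ^+ #|[set x in a | r x]| = \prod_(x in a) (if r x then -1 else 1) :> R.
Proof. by rewrite -big_mkcondr -prodr_const; apply: eq_bigl => x; rewrite inE. Qed.

(** The new inversions are the pairs of [e] with some [x] that the orders place on different sides
    of [e]; their parity is the difference of the two counts of predecessors. *)
Lemma inversion_sign_setU1 e (a : {set I}) : e \notin a ->
  ~~ r1 e e ->
  (forall x, x \in a -> r1 e x = ~~ r1 x e /\ r2 e x = ~~ r2 x e) ->
  inversion_sign (e |: a) * (-1) ^+ #|[set x in a | r1 x e]| =
  inversion_sign a * (-1) ^+ #|[set x in a | r2 x e]|.
Proof.
move=> ea; pose s x y : R := if r1 x y && r2 y x then -1 else 1.
have E : \prod_(x in a) \prod_(y in e |: a) s x y =
    \prod_(x in a) s x e * \prod_(x in a) \prod_(y in a) s x y.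
  by rewrite -big_split; apply: eq_bigr => x _; rewrite big_setU1.
move=> ree tot; rewrite !sign_card /inversion_sign big_setU1 //= big_setU1 //= E.
rewrite (negPf ree) mul1r mulrA [LHS]mulrAC [LHS]mulrC; congr (_ * _).
rewrite -!big_split; apply: eq_bigr => x /tot[e1 e2]; rewrite /= /s e1 e2.
by case: (r1 x e); case: (r2 x e); rewrite /= ?mul1r ?mulr1 ?mulrNN ?mulr1.
Qed.
End ReorderSign.

Lemma index_total (T : eqType) (s : seq T) x y : x \in s -> y \in s -> x != y ->
  (index x s < index y s)%N = ~~ (index y s < index x s)%N.
Proof.
move=> xs ys xy; rewrite -leqNgt ltn_neqAle andb_idl // => _.
by apply: contra xy => /eqP E; rewrite -(nth_index x xs) E nth_index.
Qed.

(** * The isomorphism of complexes for two edge orders *)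

Section ChainIso.
Variables (P P' : pm_graph) (phi : P -> P') (psi : P' -> P).
Hypothesis iso : pm_iso phi psi.
Variables (R : comNzRingType) (F : MTQFT R).
Variables (ord : seq {set P}) (ord' : seq {set P'}).
Hypotheses (ordP : perm_eq ord (enum (pm_match P)))
           (ordP' : perm_eq ord' (enum (pm_match P'))).

Let before (e e' : {set P}) := (index e ord < index e' ord)%N.
Let before' (e e' : {set P}) := (index (phi @: e) ord' < index (phi @: e') ord')%N.
Let sign (a : {set {set P}}) : R := inversion_sign R before before' a.
Let push : cx_basis F P -> cx_basis F P' := push_basis iso (F := F).
Let pull : cx_basis F P' -> cx_basis F P := push_basis (pm_iso_sym iso) (F := F).
Let pushK : cancel push pull. Proof. exact: push_basisK. Qed.
Let pullK : cancel pull push. Proof. exact: push_basisK. Qed.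
Let img_inj : injective (fun A : {set P} => phi @: A).
Proof. exact/imset_inj/(can_inj (iso_K iso)). Qed.

Lemma sign_step (a : {set {set P}}) e : a \subset pm_match P -> e \in pm_match P ->
  e \notin a ->
  sign (e |: a) * (-1) ^+ #|[set e' in a | before e' e]| =
  sign a * (-1) ^+ #|[set e' in a | before' e' e]|.
Proof.
move=> aM eM ea; apply: inversion_sign_setU1; rewrite // /before ?ltnn // => x xa.
have ex : e != x by apply: contra ea => /eqP->.
have xM := subsetP aM _ xa.
split; apply: index_total; rewrite ?(inj_eq img_inj) // (perm_mem ordP, perm_mem ordP');
  by rewrite mem_enum ?(iso_match iso).
Qed.

(** The chain map condition, entry by entry: [sign_step] converts the sign counted in the target
    order, pulled back along [phi], into the one counted in the source order. *)
Lemma diff_entry_push b b1 :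
  sign (val (tag b)) * diff_entry ord' (push b) (push b1) =
  sign (val (tag b1)) * diff_entry ord b b1.
Proof.
rewrite /diff_entry !mulr_sumr.
have img_bij : bijective (fun A : {set P} => phi @: A).
  by exists (fun A : {set P'} => psi @: A) => A; apply: imsetK;
    [exact: iso_K iso | exact: iso_K' iso].
rewrite (reindex _ (onW_bij _ img_bij)) /=.
apply: eq_big => [e|e].
  rewrite (iso_match iso) mem_imset //; congr (_ && (_ && _)).
  by rewrite -(inj_eq (imset_inj img_inj)) imsetU1.
rewrite (iso_match iso) mem_imset // => /and3P[eM ea /eqP b1E].
have -> : val (tag b1) = e |: val (tag b).
  by apply: (imset_inj img_inj); rewrite imsetU1.
rewrite edge_entry_push !mulrA sign_step ?(valP (tag b)) //; congr (_ * (-1) ^+ _ * _).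
rewrite -(card_imset _ img_inj); congr #|pred_of_set _|.
apply/setP => f; rewrite inE; apply/andP/imsetP.
  by case=> /imsetP[g ga ->] lt; exists g; rewrite ?inE ?ga.
by case=> g; rewrite inE => /andP[ga lt] ->; rewrite mem_imset.
Qed.

(** Relabelling followed by a rescaling constant on each state; the sign squares to one, so the
    inverse rescales by the same factor. *)
Definition transport (v : cx F P) : cx F P' :=
  [ffun b => sign (val (tag (pull b))) * v (pull b)].

Lemma transport_linear : linear transport.
Proof.
move=> a u v; apply/ffunP => b; rewrite !ffunE mulrDr; congr (_ + _).
by rewrite /GRing.scale /= mulrCA.
Qed.

HB.instance Definition _ := GRing.isLinear.Build R (cx F P) (cx F P') _ transport
  transport_linear.

Lemma transport_bij : bijective transport.
Proof.
exists (fun w : cx F P' => [ffun b => sign (val (tag b)) * w (push b)] : cx F P).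
  by move=> v; apply/ffunP => b; rewrite !ffunE pushK mulrA inversion_sign_sqr mul1r.
by move=> v; apply/ffunP => b; rewrite !ffunE pullK mulrA inversion_sign_sqr mul1r.
Qed.

Lemma transport_diff v : diff F ord' (transport v) = transport (diff F ord v).
Proof.
apply/ffunP => b1; rewrite -(pullK b1) [RHS]ffunE pushK !ffunE mulr_sumr.
rewrite (reindex push) /=; last by apply: onW_bij; exists pull.
apply: eq_bigr => b _; rewrite ffunE pushK mulrAC diff_entry_push.
by rewrite -mulrA [_ * v b]mulrC.
Qed.

Lemma transport_homogeneous (G : zmodType) (deg : mt_basis F -> G) shift
    (D : eqType) (d : D) (k : nat -> G -> D) v :
  homogeneous (fun b => k (hdeg b) (gdeg deg shift b)) d v <->
  homogeneous (fun b => k (hdeg b) (gdeg deg shift b)) d (transport v).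
Proof.
have E b : (transport v b == 0) = (v (pull b) == 0).
  rewrite ffunE; apply/eqP/eqP => [E|->]; last by rewrite mulr0.
  have s2 := inversion_sign_sqr R before before' (val (tag (pull b))).
  by rewrite -[LHS]mul1r -s2 -mulrA E mulr0.
split=> hv b; last first.
  by rewrite -(pushK b) -E => /hv; rewrite pushK hdeg_push gdeg_push.
by rewrite E => /hv; rewrite /pull hdeg_push gdeg_push.
Qed.

End ChainIso.

(** Independence of the edge order is the instance of the identity equivalence with two different
    lists [ord] and [ord']. *)
Lemma poincare_invariant (R : comNzRingType) (F : MTQFT R) (G : zmodType)
    (deg : mt_basis F -> G) (shift : G) (dim : lmodType R -> int)
    (P P' : pm_graph) (ord : seq {set P}) (ord' : seq {set P'}) :
  extends_rank dim -> pm_equiv P P' ->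
  perm_eq ord (enum (pm_match P)) -> perm_eq ord' (enum (pm_match P')) ->
  poincare deg shift ord dim = poincare deg shift ord' dim.
Proof.
move=> [dim_iso _] /pm_equiv_iso[phi [psi iso]] ordP ordP'.
rewrite /poincare (iso_card_match iso); apply: eq_bigr => i _; congr (_ *: _).
apply: eq_fsbigr => g _; congr (_ *~ _); apply: dim_iso.
pose T : {linear cx F P -> cx F P'} := transport iso ord ord'.
apply: (@homology_iso _ _ _ _ _ _ _ _ _ T).
- exact: transport_bij.
- exact: transport_diff.
- move=> D d k v; exact: transport_homogeneous.
Qed.

Theorem theorem3p3p17
  (R : comNzRingType) (F : MTQFT R)
  (G : zmodType) (m : nat) (g : 'I_m -> G)
  (g_generate : forall x : G, exists p : 'I_m -> int, x = \sum_j g j *~ p j)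
  (deg : mt_basis F -> G) (s : 'I_m -> int)
  (dim : lmodType R -> int) (dim_rank : extends_rank dim)
  (m_squared : forall v, mt_m F (mt_m F v) = mt_mu F (mt_Delta F v))
  (mu_degree : forall (x : G) v,
     homogeneous (fun b => deg b.1 + deg b.2) x v ->
     homogeneous deg (x - \sum_j g j *~ s j) (mt_mu F v))
  (Delta_degree : forall (x : G) v,
     homogeneous deg x v ->
     homogeneous (fun b => deg b.1 + deg b.2) (x - \sum_j g j *~ s j) (mt_Delta F v))
  (m_degree : forall (x : G) v,
     homogeneous deg x v ->
     homogeneous deg (x - \sum_j g j *~ s j) (mt_m F v)) :
  (forall (P P' : pm_graph) (ord : seq {set P}) (ord' : seq {set P'}),
     trivalent P -> trivalent P' -> pm_equiv P P' ->
     perm_eq ord (enum (pm_match P)) -> perm_eq ord' (enum (pm_match P')) ->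
     poincare deg (\sum_j g j *~ s j) ord dim =
     poincare deg (\sum_j g j *~ s j) ord' dim)
  /\
  (forall P : pm_graph, trivalent P ->
     forall z : group_ring G,
       bracket 1 (- \prod_j gmon (g j *~ s j))
         (qdim dim (fun x => sub_mod (graded_piece R deg x)))
         (diagram_of P) z
       <-> z = euler_char deg (\sum_j g j *~ s j) P dim).
Proof.
split=> [P P' ord ord' _ _ PP' ordP ordP' | P P3 z].
  exact: poincare_invariant.
by rewrite -gmon_sum; exact: bracket_euler_char.
Qed.
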